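(* Let $\mu\colon Z^1(M)\to B^1(M)$ be a homomorphism, let $c\neq0$ (so $c>0$), and write $\Delta=\Delta_{(\mu,c)}$. Let $\psi\in\mathrm{Symp}_0(M,\omega)$. For all $\phi\in\mathrm{Symp}_0(M,\omega)$, $$|\Delta(\psi\phi)-\Delta(\phi)|\leq R(\psi)\qquad\text{with}\quad R(\psi)=\max\{\Delta(\psi),\Delta(\psi^{-1})\}.$$
   Context: $(M,\omega)$ is a closed symplectic manifold; $Z^1(M)$ and $B^1(M)$ are the real vector spaces of closed and exact smooth $1$-forms on $M$. Fix a norm $n^B$ on $B^1(M)$ and a Riemannian metric $g$ on $M$; $\|\cdot\|_{L^2}$ is the $L^2$-norm on $1$-forms induced by $g$. For a homomorphism (linear map) $\mu\colon Z^1(M)\to B^1(M)$ and a real number $c\geq0$, set $n_{(\mu,c)}(\alpha)=n^B(\mu(\alpha))+c\|\alpha-\mu(\alpha)\|_{L^2}$ for $\alpha\in Z^1(M)$. $\mathrm{Symp}_0(M,\omega)$ is the identity component of the group of symplectomorphisms. A (smooth) path $\Psi=\{\psi_t\}_{t\in[0,1]}$ of symplectomorphisms with $\psi_0=\mathrm{id}$ corresponds to the path $\alpha(\Psi)=\{\alpha(\Psi)_t\}_{t\in[0,1]}$ in $Z^1(M)$ given by $\alpha(\Psi)_t=\omega(X_t^\Psi,\cdot)$, where $\partial_t\psi_t=X_t^\Psi(\psi_t)$. $\mathrm{Ham}(M,\omega)$ is the group of Hamiltonian diffeomorphisms: the endpoints $\psi_1$ of such paths with $\alpha(\Psi)_t\in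 B^1(M)$ for all $t$. The length of $\Psi$ is $\ell_{(\mu,c)}(\Psi)=\int_0^1 n_{(\mu,c)}(\alpha(\Psi)_t)\,dt$. For $\phi,\psi\in\mathrm{Symp}_0(M,\omega)$, $d_{(\mu,c)}(\mathrm{id},\phi)$ is the infimum of $\ell_{(\mu,c)}(\Phi)$ over all paths $\Phi$ of symplectomorphisms from $\mathrm{id}$ to $\phi$, $d_{(\mu,c)}(\phi,\psi)=d_{(\mu,c)}(\mathrm{id},\phi^{-1}\psi)$, and $\Delta_{(\mu,c)}(\psi)=\inf\{d_{(\mu,c)}(\varphi,\psi)\,|\,\varphi\in\mathrm{Ham}(M,\omega)\}$. *)

(* Defs.v *)
From HB Require Import structures.
From mathcomp Require Import all_boot all_order all_algebra.
From mathcomp Require Import all_classical all_reals all_analysis.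
From mathcomp Require Import ring.

Set Implicit Arguments.
Unset Strict Implicit.
Unset Printing Implicit Defensive.
Import Order.TTheory GRing.Theory Num.Theory.
Import numFieldNormedType.Exports.
Local Open Scope classical_set_scope.
Local Open Scope ring_scope.

Section Smoothness.
Context {R : realType} {V W : normedModType R}.

(* V is finite-dimensional in every use below, so that continuity of all the
   directional derivatives is continuity of the differential. *)
Fixpoint Ck (k : nat) (U : set V) (f : V -> W) : Prop :=
  if k is k'.+1 then
    (forall x, U x -> differentiable f x) /\ (forall v, Ck k' U ('D_v f))
  else forall x, U x -> {for x, continuous f}.

(* A need not be open: near each of its points f is the restriction of a
   C^oo function defined on an open set. *)
Definition smooth_on (A : set V) (f : V -> W) : Prop :=
  forall x, A x -> exists U g,
    [/\ open U, U x, forall k, Ck k U g & {in A `&` U, g =1 f}].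

End Smoothness.

Section CkTheory.
Context {R : realType} {V : normedModType R}.
Implicit Types (U : set V) (f g : V -> R^o).

Lemma near_eq_differentiable (W : normedModType R) (f g : V -> W) x :
  (\forall y \near x, f y = g y) -> differentiable f x -> differentiable g x.
Proof.
move=> fg dfx; have cdf := diff_continuous dfx.
have gE : g \o shift x = cst (g x) + 'd f x +o_ 0 id.
  apply/eqaddoP => e e0; have /eqaddoP/(_ e e0) := diff_locally dfx.
  have fg0 : \forall y \near (0 : V), f (y + x) = g (y + x).
    by move: fg; rewrite (near_shift 0 x) subr0.
  apply: filterS2 fg0.
  move=> y /= fgy; congr (`| _ | <= _).
  by rewrite !fctE /= fgy (nbhs_singleton fg).
have dgE : 'd g x = 'd f x :> (V -> W) by exact: diff_unique.
by apply/diff_locallyP; rewrite dgE.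
Qed.

Lemma Ck_ext k U f g : open U -> {in U, f =1 g} -> Ck k U f -> Ck k U g.
Proof.
move=> oU; elim: k f g => [|k IH] f g fg /=.
  move=> cf x Ux; have := cf x Ux; rewrite /prop_for /continuous_at.
  rewrite -(fg x (mem_set Ux)); apply: cvg_trans; apply: near_eq_cvg.
  have := open_nbhs_nbhs (conj oU Ux); apply: filterS => y Uy.
  by rewrite (fg y (mem_set Uy)).
have near_fg x : U x -> \forall y \near x, f y = g y.
  move=> Ux; have := open_nbhs_nbhs (conj oU Ux).
  by apply: filterS => y Uy; rewrite (fg y (mem_set Uy)).
move=> [df Df]; split=> [x Ux|v].
  exact: near_eq_differentiable (near_fg x Ux) (df x Ux).
apply: IH (Df v) => x /set_mem Ux; exact/near_eq_derive/near_fg.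
Qed.

Lemma CkW k U f : Ck k.+1 U f -> Ck k U f.
Proof.
elim: k f => [|k IH] f [df Df].
  by move=> x Ux; exact/differentiable_continuous/df.
by split=> // v; exact: IH (Df v).
Qed.

Lemma Ck_sub k U U' f : U' `<=` U -> Ck k U f -> Ck k U' f.
Proof.
move=> sU; elim: k f => [|k IH] f /=; first by move=> cf x /sU; exact: cf.
by move=> [df Df]; split=> [x /sU|v]; [exact: df|exact: IH (Df v)].
Qed.

Lemma Ck_cst k U (a : R) : Ck k U (cst a : V -> R^o).
Proof.
elim: k a => [|k IH] a /=; first by move=> x _; exact: cst_continuous.
split=> [x _|v]; first exact: differentiable_cst.
rewrite (_ : 'D_v _ = cst 0); first exact: IH.
by apply/funext => x; exact: (derive_cst (a : R^o) x v).
Qed.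

Lemma CkD k U f g : open U -> Ck k U f -> Ck k U g -> Ck k U (f + g).
Proof.
move=> oU; elim: k f g => [|k IH] f g /=.
  by move=> cf cg x Ux; exact: continuousD (cf x Ux) (cg x Ux).
move=> [df Df] [dg Dg]; split=> [x Ux|v].
  exact: differentiableD (df x Ux) (dg x Ux).
apply: (@Ck_ext _ _ ('D_v f + 'D_v g)) => //; last exact: IH (Df v) (Dg v).
move=> x /set_mem Ux; rewrite deriveD //.
  exact/diff_derivable/df.
exact/diff_derivable/dg.
Qed.

Lemma CkM k U f g : open U -> Ck k U f -> Ck k U g ->
  Ck k U (f * g : V -> R^o).
Proof.
move=> oU; elim: k f g => [|k IH] f g.
  by move=> cf cg x Ux; exact: continuousM (cf x Ux) (cg x Ux).
move=> kf kg; have [[df Df] [dg Dg]] := (kf, kg); split=> [x Ux|v].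
  exact: differentiableM (df x Ux) (dg x Ux).
apply: (@Ck_ext _ _ (f * 'D_v g + g * 'D_v f)) => //; last first.
  exact: CkD oU (IH _ _ (CkW kf) (Dg v)) (IH _ _ (CkW kg) (Df v)).
move=> x /set_mem Ux; rewrite deriveM //.
  exact/diff_derivable/df.
exact/diff_derivable/dg.
Qed.

End CkTheory.

Section SmoothTheory.
Context {R : realType} {V : normedModType R}.
Implicit Types (A : set V) (f g : V -> R^o).

Lemma smooth_on_cst A (a : R) : smooth_on A (cst a : V -> R^o).
Proof.
move=> x _; exists setT, (cst a); split=> //; first exact: openT.
by move=> k; exact: Ck_cst.
Qed.

Let smooth_op (op : R -> R -> R) A f g :
  (forall k U f' g', open U -> Ck k U f' -> Ck k U g' ->
     Ck k U ((fun x => op (f' x) (g' x)) : V -> R^o)) ->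
  smooth_on A f -> smooth_on A g ->
  smooth_on A ((fun x => op (f x) (g x)) : V -> R^o).
Proof.
move=> Ckop sf sg x Ax.
have [U [f' [oU Ux kf ff']]] := sf x Ax; have [U' [g' [oU' Ux' kg gg']]] := sg x Ax.
exists (U `&` U'), (fun x => op (f' x) (g' x)); split=> //.
- exact: openI.
- move=> k; apply: Ckop; first exact: openI.
    by apply: Ck_sub (kf k) => y [].
  by apply: Ck_sub (kg k) => y [].
- by move=> y /set_mem [Ay [Uy U'y]]; rewrite ff' ?gg' //; apply/mem_set.
Qed.

Lemma smooth_onD A f g : smooth_on A f -> smooth_on A g -> smooth_on A (f + g).
Proof. by apply: (smooth_op (op := +%R)) => *; exact: CkD. Qed.

Lemma smooth_onM A f g : smooth_on A f -> smooth_on A g ->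
  smooth_on A (f * g : V -> R^o).
Proof. by apply: (smooth_op (op := *%R)) => *; exact: CkM. Qed.

End SmoothTheory.

Record chart (R : realType) (n : nat) (M : topologicalType) := Chart {
  chart_dom : set M;
  chart_map : M -> 'rV[R]_n;
  chart_inv : 'rV[R]_n -> M;
  chart_dom_open : open chart_dom;
  chart_img_open : open (chart_map @` chart_dom);
  chart_mapK : {in chart_dom, cancel chart_map chart_inv};
  chart_map_cont : forall x, chart_dom x -> {for x, continuous chart_map};
  chart_inv_cont : forall u, (chart_map @` chart_dom) u ->
    {for u, continuous chart_inv}
}.

Definition chart_img (R : realType) (n : nat) (M : topologicalType)
  (c : chart R n M) : set 'rV[R]_n := chart_map c @` chart_dom c.

(* Closed manifold: compact and without boundary.  Second countability follows
   from compactness. *)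
Record closedManifold (R : realType) := ClosedManifold {
  carrier :> ptopologicalType;
  dim : nat;
  atlas : set (chart R dim carrier);
  manifold_hausdorff : hausdorff_space carrier;
  manifold_compact : compact [set: carrier];
  atlas_cover : forall x, exists2 c, atlas c & chart_dom c x;
  atlas_compat : forall c d, atlas c -> atlas d ->
    smooth_on (chart_map c @` (chart_dom c `&` chart_dom d))
              (chart_map d \o chart_inv c)
}.
Arguments dim {R} M : rename.
Arguments atlas {R} M : rename.

Section Manifold.
Context {R : realType} (M : closedManifold R).

Definition smooth_fun : {pred M -> R^o} := fun f =>
  `[< forall c, atlas M c -> smooth_on (chart_img c) (f \o chart_inv c) >].

Lemma smooth_fun_subring_closed : subring_closed smooth_fun.
Proof.
split=> [|f h /asboolP sf /asboolP sh|f h /asboolP sf /asboolP sh].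
- apply/asboolP => c _; rewrite (_ : _ \o _ = cst 1) //.
  exact: smooth_on_cst.
- apply/asboolP => c Mc; rewrite (_ : _ \o _ = f \o chart_inv c +
    ((cst (-1)) * (h \o chart_inv c) : _ -> R^o)).
    apply: smooth_onD; first exact: sf.
    by apply: smooth_onM; [exact: smooth_on_cst | exact: sh].
  by apply/funext => u /=; rewrite !fctE /= mulN1r.
- by apply/asboolP => c Mc; apply: smooth_onM; [exact: sf | exact: sh].
Qed.
HB.instance Definition _ :=
  GRing.isSubringClosed.Build _ smooth_fun smooth_fun_subring_closed.

Lemma smooth_fun_scaler_closed : scaler_closed smooth_fun.
Proof.
move=> a f /asboolP sf; apply/asboolP => c Mc.
rewrite (_ : _ \o _ = (cst a * (f \o chart_inv c) : _ -> R^o)) //.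
by apply: smooth_onM; [exact: smooth_on_cst | exact: sf].
Qed.
HB.instance Definition _ :=
  GRing.isScaleClosed.Build _ _ smooth_fun smooth_fun_scaler_closed.

(* The algebra of smooth functions. *)
Record Cinf := MkCinf { Cinf_val :> M -> R^o; _ : Cinf_val \in smooth_fun }.
HB.instance Definition _ := [isSub for Cinf_val].
HB.instance Definition _ := [Choice of Cinf by <:].
HB.instance Definition _ := [SubChoice_isSubComNzRing of Cinf by <:].
HB.instance Definition _ := [SubZmodule_isSubLmodule of Cinf by <:].

Lemma Cinf_scalerAr (a : R) (f h : Cinf) : f * (a *: h) = a *: (f * h).
Proof. by apply/val_inj/funext => x; exact: mulrCA. Qed.

(* Vector fields are the derivations of the algebra of smooth functions and
   differential forms are Cinf-multilinear maps on them, as in Helgason,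
   Differential Geometry, Lie Groups, and Symmetric Spaces, Ch. I, 2. *)
Definition derivation : {pred Cinf -> Cinf^o} := fun X =>
  `[< (forall (a : R) f h, X (a *: f + h) = a *: (X f : Cinf) + X h) /\
      (forall f h, X (f * h) = f * X h + h * X f) >].

Lemma derivation_submod_closed : submod_closed derivation.
Proof.
split=> [|k X Y /asboolP[lX mX] /asboolP[lY mY]]; apply/asboolP; split.
- by move=> a f h; rewrite -[LHS]/(0 : Cinf) -[RHS]/(a *: 0 + 0 : Cinf)
    scaler0 addr0.
- by move=> f h; rewrite -[LHS]/(0 : Cinf) -[RHS]/(f * 0 + h * 0) !mulr0 addr0.
- move=> a f h; rewrite -[LHS]/(k * X (a *: f + h) + Y (a *: f + h)).
  rewrite -[RHS]/(a *: (k * X f + Y f) + (k * X h + Y h)) lX lY.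
  by rewrite mulrDr Cinf_scalerAr scalerDr addrACA.
- move=> f h; rewrite -[LHS]/(k * X (f * h) + Y (f * h)).
  rewrite -[RHS]/(f * (k * X h + Y h) + h * (k * X f + Y f)) mX mY; ring.
Qed.
HB.instance Definition _ := GRing.isSubmodClosed.Build _ _ derivation
  (GRing.submod_closed_semi derivation_submod_closed).

Record VF := MkVF { VF_val :> Cinf -> Cinf^o; _ : VF_val \in derivation }.
HB.instance Definition _ := [isSub for VF_val].
HB.instance Definition _ := [Choice of VF by <:].
HB.instance Definition _ := [SubChoice_isSubLmodule of VF by <:].

Lemma VF_derivation (X : VF) :
  (forall (a : R) f h, X (a *: f + h) = a *: (X f : Cinf) + X h) /\
  (forall f h, X (f * h) = f * X h + h * X f).
Proof. by case: X => X /= /asboolP. Qed.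

Lemma lie_bracket_subproof (X Y : VF) :
  (fun f : Cinf => X (Y f) - Y (X f) : Cinf^o) \in derivation.
Proof.
have [lX mX] := VF_derivation X; have [lY mY] := VF_derivation Y.
have XD f h : X (f + h) = X f + X h by have := lX 1 f h; rewrite !scale1r.
have YD f h : Y (f + h) = Y f + Y h by have := lY 1 f h; rewrite !scale1r.
apply/asboolP; split=> [a f h|f h].
  by rewrite lX lY lX lY scalerBr opprD addrACA.
by rewrite mX mY XD YD !mX !mY; ring.
Qed.

Definition lie_bracket (X Y : VF) : VF := MkVF (lie_bracket_subproof X Y).

Definition one_form (alpha : VF -> Cinf) : Prop :=
  forall (f : Cinf) X Y, alpha (f *: X + Y) = f * alpha X + alpha Y.

Definition closed_form : {pred VF -> Cinf} := fun alpha =>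
  `[< one_form alpha /\ forall X Y : VF,
      X (alpha Y) - Y (alpha X) - alpha (lie_bracket X Y) = 0 >].

Definition exact_form : {pred VF -> Cinf} := fun alpha =>
  `[< exists f : Cinf, forall X : VF, alpha X = X f >].

Lemma closed_form_submod_closed : submod_closed closed_form.
Proof.
split=> [|a alpha beta /asboolP[la ca] /asboolP[lb cb]]; apply/asboolP; split.
- by move=> f X Y; rewrite -[LHS]/(0 : Cinf) -[RHS]/(f * 0 + 0 : Cinf)
    mulr0 addr0.
- move=> X Y; have X0 (Z : VF) : Z (0 : Cinf) = 0.
    by have := (VF_derivation Z).1 (-1) 0 0; rewrite !scaleN1r oppr0 addr0 addNr.
  by rewrite -[LHS]/(X 0 - Y 0 - 0 : Cinf) !X0 !subr0.
- move=> f X Y; rewrite -[LHS]/(a *: alpha (f *: X + Y) + beta (f *: X + Y)).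
  rewrite -[RHS]/(f * (a *: alpha X + beta X) + (a *: alpha Y + beta Y)) la lb.
  by rewrite mulrDr Cinf_scalerAr scalerDr addrACA.
- move=> X Y.
  rewrite -[LHS]/(X (a *: alpha Y + beta Y) - Y (a *: alpha X + beta X) -
    (a *: alpha (lie_bracket X Y) + beta (lie_bracket X Y))).
  rewrite (VF_derivation X).1 (VF_derivation Y).1.
  transitivity (a *: (X (alpha Y) - Y (alpha X) - alpha (lie_bracket X Y)) +
    (X (beta Y) - Y (beta X) - beta (lie_bracket X Y))).
    by rewrite !scalerBr; ring.
  by rewrite ca cb scaler0 addr0.
Qed.
HB.instance Definition _ := GRing.isSubmodClosed.Build _ _ closed_form
  (GRing.submod_closed_semi closed_form_submod_closed).

Lemma exact_form_submod_closed : submod_closed exact_form.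
Proof.
split=> [|a alpha beta /asboolP[f Hf] /asboolP[h Hh]]; apply/asboolP.
  exists 0 => X; have := (VF_derivation X).1 (-1) 0 0.
  by rewrite !scaleN1r oppr0 addr0 addNr => ->.
exists (a *: f + h) => X; rewrite (VF_derivation X).1 -Hf -Hh //.
Qed.
HB.instance Definition _ := GRing.isSubmodClosed.Build _ _ exact_form
  (GRing.submod_closed_semi exact_form_submod_closed).

Record Z1 := MkZ1 { Z1_val :> VF -> Cinf; _ : Z1_val \in closed_form }.
HB.instance Definition _ := [isSub for Z1_val].
HB.instance Definition _ := [Choice of Z1 by <:].
HB.instance Definition _ := [SubChoice_isSubLmodule of Z1 by <:].

Record B1 := MkB1 { B1_val :> VF -> Cinf; _ : B1_val \in exact_form }.
HB.instance Definition _ := [isSub for B1_val].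
HB.instance Definition _ := [Choice of B1 by <:].
HB.instance Definition _ := [SubChoice_isSubLmodule of B1 by <:].

Definition symplectic_form (omega : VF -> VF -> Cinf) : Prop :=
  [/\ forall Y, one_form (omega^~ Y),
      forall X Y, omega X Y = - omega Y X,
      forall X Y Z : VF,
        X (omega Y Z) + Y (omega Z X) + Z (omega X Y)
        - omega (lie_bracket X Y) Z - omega (lie_bracket Y Z) X
        - omega (lie_bracket Z X) Y = 0
    & forall (X : VF) (x : M), (forall Y, omega X Y x = 0) ->
        forall f, X f x = 0].

Definition riemannian_metric (g : VF -> VF -> Cinf) : Prop :=
  [/\ forall Y, one_form (g^~ Y),
      forall X Y, g X Y = g Y X
    & forall (X : VF) (x : M), (exists f, X f x != 0) -> 0 < g X X x].

(* X i is the i-th coordinate field of the chart c at every point of A. *)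
Definition coordinate_frame (c : chart R (dim M) M) (A : set M)
    (X : 'I_(dim M) -> VF) : Prop :=
  forall x, A x -> forall i (f : Cinf),
    X i f x = 'D_(delta_mx 0 i) (f \o chart_inv c) (chart_map c x).

End Manifold.

Arguments lie_bracket {R M} X Y.
Arguments closed_form {R M} _.
Arguments exact_form {R M} _.

(* Integral of a nonnegative function for the n-dimensional Lebesgue measure,
   as an iterated integral (Tonelli). *)
Fixpoint Rn_integral (R : realType) (n : nat) : ('rV[R]_n -> \bar R) -> \bar R :=
  match n with
  | 0 => fun f => f 0
  | n'.+1 => fun f => (\int[lebesgue_measure]_x
      Rn_integral (fun u : 'rV[R]_n' => f (row_mx (x%:M : 'rV[R]_1) u)))%E
  end.

Section Symplectic.
Context {R : realType} {M : closedManifold R}.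

(* vol is the Riemannian measure of g on the Borel sets of M: it has density
   sqrt (det g_ij) in every chart.  Coordinate fields extend to global vector
   fields near each point, so this determines vol. *)
Definition riemannian_volume (g : VF M -> VF M -> Cinf M)
    (vol : {measure set (g_sigma_algebraType (@open M)) -> \bar R}) : Prop :=
  forall (c : chart R (dim M) M) (A : set M) (X : 'I_(dim M) -> VF M),
    atlas M c -> A `<=` chart_dom c ->
    measurable (A : set (g_sigma_algebraType (@open M))) ->
    coordinate_frame c A X ->
    vol A = Rn_integral (fun u =>
      (\1_(chart_map c @` A) u *
       Num.sqrt (\det (\matrix_(i, j) g (X i) (X j) (chart_inv c u))))%:E).

(* Pointwise norm of a 1-form, dual to the norm of tangent vectors. *)
Definition covector_norm (g : VF M -> VF M -> Cinf M)
    (alpha : VF M -> Cinf M) (x : M) : R :=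
  sup [set alpha X x | X in [set X : VF M | g X X x <= 1]].

Definition L2norm (g : VF M -> VF M -> Cinf M)
    (vol : {measure set (g_sigma_algebraType (@open M)) -> \bar R})
    (alpha : VF M -> Cinf M) : R :=
  Num.sqrt (\int[vol]_(x in [set: M]) (covector_norm g alpha x ^+ 2)).

Definition is_norm (V : lmodType R) (N : V -> R) : Prop :=
  [/\ forall v, N v = 0 -> v = 0,
      forall a v, N (a *: v) = `|a| * N v
    & forall v w, N (v + w) <= N v + N w].

Definition smooth_map (psi : M -> M) : Prop :=
  continuous psi /\ forall c d, atlas M c -> atlas M d ->
    smooth_on (chart_map c @` (chart_dom c `&` psi @^-1` chart_dom d))
              (chart_map d \o psi \o chart_inv c).

Definition diffeomorphism (psi : M -> M) : Prop :=
  smooth_map psi /\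
  exists phi, [/\ smooth_map phi, cancel psi phi & cancel phi psi].

(* X' is the pushforward of X by psi. *)
Definition related (psi : M -> M) (X X' : VF M) : Prop :=
  forall f h : Cinf M, (forall x, h x = f (psi x)) ->
    forall x, X h x = X' f (psi x).

Definition symplectomorphism (omega : VF M -> VF M -> Cinf M) (psi : M -> M) :=
  diffeomorphism psi /\
  forall X X' Y Y', related psi X X' -> related psi Y Y' ->
    forall x, omega X Y x = omega X' Y' (psi x).

(* The inverse map when psi is bijective. *)
Definition inv_map (psi : M -> M) : M -> M :=
  fun y => xget y [set x | psi x = y].

(* Paths are functions on R of which only the restriction to [0, 1] matters. *)
Definition smooth_path (Psi : R -> M -> M) : Prop :=
  {within `[0, 1] `*` setT,
    continuous (fun p : R * M => Psi p.1 p.2)} /\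
  forall c d, atlas M c -> atlas M d ->
    smooth_on [set p : R^o * 'rV[R]_(dim M) |
                [/\ 0 <= p.1 <= 1, chart_img c p.2
                  & chart_dom d (Psi p.1 (chart_inv c p.2))]]
              (fun p => chart_map d (Psi p.1 (chart_inv c p.2))).

Variable omega : VF M -> VF M -> Cinf M.

Definition symp_path (Psi : R -> M -> M) : Prop :=
  [/\ smooth_path Psi,
      forall t, 0 <= t <= 1 -> symplectomorphism omega (Psi t)
    & Psi 0 = id].

(* The identity component for smooth paths: the symplectomorphisms that are
   symplectically isotopic to the identity. *)
Definition Symp0 : set (M -> M) := [set Psi 1 | Psi in symp_path].

(* The unique vector field X_t with d/dt Psi_t = X_t (Psi_t); the derivative is
   one-sided at 0 and 1. *)
Definition velocity (Psi : R -> M -> M) (t : R) : VF M :=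
  xget 0 [set X : VF M | forall (f : Cinf M) x,
    (s - t)^-1 * (f (Psi s x) - f (Psi t x)) @[s --> within `[0, 1] t^']
      --> X f (Psi t x)].

Definition alpha_path (Psi : R -> M -> M) (t : R) : VF M -> Cinf M :=
  omega (velocity Psi t).

Definition Ham : set (M -> M) :=
  [set Psi 1 | Psi in [set Psi | symp_path Psi /\
    forall t, 0 <= t <= 1 -> alpha_path Psi t \in exact_form]].

Variables (g : VF M -> VF M -> Cinf M)
  (vol : {measure set (g_sigma_algebraType (@open M)) -> \bar R})
  (nB : B1 M -> R) (mu : Z1 M -> B1 M) (c : R).

Definition n_mu (alpha : Z1 M) : R :=
  nB (mu alpha) + c * L2norm g vol ((alpha : VF M -> Cinf M) - mu alpha).

(* alpha_path Psi t is closed whenever symp_path Psi and 0 <= t <= 1, so that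
   insubd only changes its type; its default value 0 is never reached. *)
Definition length (Psi : R -> M -> M) : R :=
  \int[lebesgue_measure]_(t in `[0, 1]) n_mu (insubd 0 (alpha_path Psi t)).

Definition dist_id (phi : M -> M) : R :=
  inf [set length Psi | Psi in [set Psi | symp_path Psi /\ Psi 1 = phi]].

Definition dist (phi psi : M -> M) : R := dist_id (inv_map phi \o psi).

Definition Delta (psi : M -> M) : R := inf [set dist phi psi | phi in Ham].

End Symplectic.

(* Main.v *)
From HB Require Import structures.
Require Import Defs.
From mathcomp Require Import all_boot all_order all_algebra.
From mathcomp Require Import all_classical all_reals all_analysis.
From mathcomp Require Import measurable_realfun ring lra.
Import Order.TTheory GRing.Theory Num.Theory.
Import numFieldNormedType.Exports.
Set Implicit Arguments.
Unset Strict Implicit.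
Unset Printing Implicit Defensive.
Local Open Scope classical_set_scope.
Local Open Scope ring_scope.

(** The flux-type seminorm Delta is subadditive on Symp_0, and the estimate is a
    formal consequence: Delta (psi phi) <= Delta psi + Delta phi gives one half,
    and writing phi = psi^-1 (psi phi) gives the other.

    Subadditivity comes from running one path after the other. A path Psi
    followed from the end of a path Phi, that is Psi_t o Phi_1, has the same
    velocity field as Psi, because the velocity is read at the moving point;
    hence the length of the concatenation is the sum of the lengths
    ([length_concat]) and the distance to the identity satisfies
    d (id, h k) <= d (id, h) + d (id, k) ([dist_id_comp]). To pass to Delta one
    chooses p, q in Ham with h and k close to p and q; then
    (p^-1 h) (q^-1 k) = r^-1 (h k) with r = (h q h^-1) p, and r is Hamiltonian
    because Ham is a normal subgroup of Symp_0 ([Ham_comp], [Ham_conj],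
    [Delta_comp]).

    The two paths have to be traversed smoothly. With the function
    exp (1 - 1/x), flat at 0, one slows both of them down near time 1/2; the
    concatenation is the pointwise composition of the two slowed paths, one of
    which is at rest at every time, so its smoothness follows from the chain
    rule ([Ck_comp], [smooth_path_comp]) and no gluing is involved. At a time
    where the clock runs at speed a the velocity is a times the original one
    ([concat_velocity_left], [concat_velocity_right]), and n_(mu,c) is
    homogeneous.

    The map mu and the norm n^B are arbitrary, so the speed t |-> n_(mu,c) of a
    path can fail to be measurable. The integral of a nonnegative function is
    then the supremum of the integrals of the simple functions below it. This
    lower integral is still additive over disjoint measurable sets
    ([lower_integral_setU]) and still satisfies the change of variables formula
    for a smooth increasing substitution ([lower_integral_subst]). Equality
    is needed there, not just an inequality, as an infinite integral counts as
    length 0. *)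

(** * Calculus of C^k maps between normed modules *)

Section CkCalculus.
Context {R : realType} {V : normedModType R}.

Section Codomain.
Context {W : normedModType R}.
Implicit Types (U : set V) (f g : V -> W).

Lemma eq_Ck k U f g : open U -> {in U, f =1 g} -> Ck k U f -> Ck k U g.
Proof.
move=> oU; elim: k f g => [|k IH] f g fg /=.
  move=> cf x Ux; have := cf x Ux; rewrite /prop_for /continuous_at.
  rewrite -(fg x (mem_set Ux)); apply: cvg_trans; apply: near_eq_cvg.
  have := open_nbhs_nbhs (conj oU Ux); apply: filterS => y Uy.
  by rewrite (fg y (mem_set Uy)).
have near_fg x : U x -> \forall y \near x, f y = g y.
  move=> Ux; have := open_nbhs_nbhs (conj oU Ux).
  by apply: filterS => y Uy; rewrite (fg y (mem_set Uy)).
move=> [df Df]; split=> [x Ux|v].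
  exact: near_eq_differentiable (near_fg x Ux) (df x Ux).
apply: IH (Df v) => x /set_mem Ux; exact/near_eq_derive/near_fg.
Qed.

Lemma Ck_le k U f : Ck k.+1 U f -> Ck k U f.
Proof.
elim: k f => [|k IH] f [df Df].
  by move=> x Ux; exact/differentiable_continuous/df.
by split=> // v; exact: IH (Df v).
Qed.

Lemma Ck_continuous k U f x : Ck k U f -> U x -> {for x, continuous f}.
Proof. by elim: k f => [|k IH] f; [apply|move=> /Ck_le; exact: IH]. Qed.

Lemma Ck_subset k U U' f : U' `<=` U -> Ck k U f -> Ck k U' f.
Proof.
move=> sU; elim: k f => [|k IH] f /=; first by move=> cf x /sU; exact: cf.
by move=> [df Df]; split=> [x /sU|v]; [exact: df|exact: IH (Df v)].
Qed.

Lemma Ck_const k U (a : W) : Ck k U (cst a : V -> W).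
Proof.
elim: k a => [|k IH] a /=; first by move=> x _; exact: cst_continuous.
split=> [x _|v]; first exact: differentiable_cst.
rewrite (_ : 'D_v _ = cst 0); first exact: IH.
by apply/funext => x; exact: (derive_cst (a : W) x v).
Qed.

Lemma Ck_add k U f g : open U -> Ck k U f -> Ck k U g -> Ck k U (f \+ g).
Proof.
move=> oU; elim: k f g => [|k IH] f g /=.
  by move=> cf cg x Ux; exact: continuousD (cf x Ux) (cg x Ux).
move=> [df Df] [dg Dg]; split=> [x Ux|v].
  exact: differentiableD (df x Ux) (dg x Ux).
apply: (@eq_Ck _ _ ('D_v f \+ 'D_v g)) => //; last exact: IH (Df v) (Dg v).
move=> x /set_mem Ux; rewrite (deriveD (f := f)) //.
  exact/diff_derivable/df.
exact/diff_derivable/dg.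
Qed.

Lemma Ck_sum k U n (F : 'I_n -> V -> W) : open U ->
  (forall i, Ck k U (F i)) -> Ck k U (fun x => \sum_(i < n) F i x).
Proof.
move=> oU; elim: n F => [|n IH] F kF.
  by apply: (@eq_Ck _ _ (cst 0)) => // [x _|]; rewrite ?big_ord0//; exact: Ck_const.
apply: (@eq_Ck _ _ ((fun x => \sum_(i < n) F (widen_ord (leqnSn n) i) x)
   \+ F ord_max)) => // [x _|]; first by rewrite big_ord_recr.
by apply: Ck_add => //; exact: IH.
Qed.

Lemma Ck_linear k U (L : {linear V -> W}) : continuous L -> Ck k U L.
Proof.
move=> cL; case: k => [|k] /=; first by move=> x _; exact: cL.
split=> [x _|v]; first exact: linear_differentiable.
rewrite (_ : 'D_v L = cst (L v)); first exact: Ck_const.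
apply/funext => x; rewrite deriveE; last exact: linear_differentiable.
by rewrite diff_lin.
Qed.

End Codomain.

Lemma Ck_linear_comp {W Z : normedModType R} k U (f : V -> W)
    (L : {linear W -> Z}) :
  open U -> continuous L -> Ck k U f -> Ck k U (L \o f).
Proof.
move=> oU cL; elim: k f => [|k IH] f /=.
  by move=> cf x Ux; apply: continuous_comp; [exact: cf|exact: cL].
have dL y : differentiable L y by exact: linear_differentiable.
move=> [df Df]; split=> [x Ux|v].
  by apply: differentiable_comp; [exact: df|exact: dL].
apply: (@eq_Ck _ _ _ (L \o 'D_v f)) => //; last exact: IH (Df v).
move=> x /set_mem Ux /=; rewrite !deriveE //; last exact: df.
  by rewrite (diff_comp (df _ Ux) (dL _)) /= diff_lin.
by apply: differentiable_comp; [exact: df|exact: dL].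
Qed.

End CkCalculus.

(** Finite dimensionality, in the form used by the chain rule below: a finite
    family of continuous coordinate functions. *)
Definition has_coordinates {R : realType} (W : normedModType R) : Prop :=
  exists n (e : 'I_n -> W) (p : 'I_n -> {linear W -> R^o}),
    (forall i, continuous (p i)) /\ forall w, w = \sum_(i < n) p i w *: e i.

Section ChainRule.
Context {R : realType}.

Lemma scalel_pack (W : normedModType R) (w : W) :
  exists L : {linear R^o -> W}, continuous L /\ forall a : R^o, L a = a *: w.
Proof.
have sx_lin : linear (( *:%R ^~ w) : R^o -> W).
  by move=> u y z; rewrite scalerDl scalerA.
pose sxlM := GRing.isLinear.Build _ _ _ _ _ sx_lin.
pose sxL : {linear R^o -> W} := HB.pack (( *:%R ^~ w) : R^o -> W) sxlM.
by exists sxL; split=> //; exact: scalel_continuous.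
Qed.

Lemma linear_pack (V W : normedModType R) (f : V -> W) : linear f ->
  exists L : {linear V -> W}, L = f :> (V -> W).
Proof.
move=> lf; pose fM := GRing.isLinear.Build _ _ _ _ _ lf.
by pose L : {linear V -> W} := HB.pack f fM; exists L.
Qed.

Lemma has_coordinates_R : has_coordinates R^o.
Proof.
exists 1, (fun=> 1 : R^o), (fun=> idfun : {linear R^o -> R^o}).
split=> [_ x|w]; first exact: cvg_id.
by rewrite big_ord1 /= /GRing.scale /= mulr1.
Qed.

Lemma has_coordinates_rV n : has_coordinates 'rV[R]_n.
Proof.
have lp i : linear (fun v : 'rV[R]_n => v 0 i : R^o) by move=> a u v; rewrite !mxE.
have /choice[p pE] i := linear_pack (lp i).
exists n, (delta_mx 0), p; split=> [i|w].
  by rewrite pE; exact: (@coord_continuous R).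
rewrite [LHS]row_sum_delta; apply: eq_bigr => i _.
by rewrite pE.
Qed.

Lemma has_coordinates_prod (V W : normedModType R) :
  has_coordinates V -> has_coordinates W ->
  has_coordinates (V * W)%type.
Proof.
move=> [n [e [p [cp pE]]]] [m [d [q [cq qE]]]].
have lp i : linear ((fun v => p i v.1) : (V * W)%type -> R^o).
  by move=> a u v /=; rewrite linearP.
have lq i : linear ((fun v => q i v.2) : (V * W)%type -> R^o).
  by move=> a u v /=; rewrite linearP.
have /choice[p' p'E] i := linear_pack (lp i).
have /choice[q' q'E] i := linear_pack (lq i).
exists (n + m)%N, (fun i => match fintype.split i with inl i => (e i, 0) | inr i => (0, d i) end),
  (fun i => match fintype.split i with inl i => p' i | inr i => q' i end).
split=> [i|w].
  case: (fintype.split i) => j; rewrite ?p'E ?q'E => x.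
    by apply: continuous_comp; [exact: cvg_fst|exact: cp].
  by apply: continuous_comp; [exact: cvg_snd|exact: cq].
rewrite big_split_ord /=.
under eq_bigr => i _ do rewrite (unsplitK (inl i)) p'E.
under [X in _ + X]eq_bigr => i _ do rewrite (unsplitK (inr i)) q'E.
rewrite [LHS]surjective_pairing {1}(pE w.1) {1}(qE w.2).
have -> : \sum_(i < n) p i w.1 *: ((e i, 0) : V * W) =
    ((\sum_(i < n) p i w.1 *: e i, 0) : V * W).
  by elim/big_rec2: _ => // i y1 y2 _ ->; congr pair; rewrite /= scaler0 addr0.
have -> : \sum_(i < m) q i w.2 *: ((0, d i) : V * W) =
    ((0, \sum_(i < m) q i w.2 *: d i) : V * W).
  by elim/big_rec2: _ => // i y1 y2 _ ->; congr pair; rewrite /= scaler0 addr0.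
by congr pair; rewrite /= ?addr0 ?add0r.
Qed.

Context {V W Z : normedModType R}.
Hypotheses (cW : has_coordinates W) (cZ : has_coordinates Z).

Let Ck_compR k (U : set V) (U' : set W) (f : V -> W) (g : W -> R^o) :
  open U -> open U' -> (forall x, U x -> U' (f x)) ->
  Ck k U f -> Ck k U' g -> Ck k U (g \o f).
Proof.
move=> oU oU' fU; have [n [e [p [cp pE]]]] := cW.
elim: k g => [|k IH] g kf kg.
  by move=> x Ux; apply: continuous_comp; [exact: kf|exact/kg/fU].
have [df Df] := kf; have [dg Dg] := kg.
split=> [x Ux|v].
  by apply: differentiable_comp; [exact: (df _ Ux)|exact/dg/fU].
apply: (@eq_Ck _ _ _ _ _ (fun x => \sum_(i < n)
    ((p i \o 'D_v f) * ('D_(e i) g \o f) : V -> R^o) x)) => //.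
  move=> x /set_mem Ux; apply/esym; rewrite deriveE; last first.
    by apply: differentiable_comp; [exact: (df _ Ux)|exact/dg/fU].
  rewrite (diff_comp (df _ Ux) (dg _ (fU _ Ux))) /=.
  rewrite -(deriveE v (df _ Ux)).
  rewrite [in LHS](pE ('D_v f x)) linear_sum; apply: eq_bigr => i _.
  by rewrite linearZ /= -deriveE //; exact/dg/fU.
apply: Ck_sum => // i; apply: CkM => //.
  exact: Ck_linear_comp (cp i) (Df v).
exact: IH (Ck_le kf) (Dg (e i)).
Qed.

(** In coordinates the chain rule writes a derivative of g \o f as a sum of
    products of derivatives of f and of derivatives of g composed with f, so
    that induction on the order applies. *)
Lemma Ck_comp k (U : set V) (U' : set W) (f : V -> W) (g : W -> Z) :
  open U -> open U' -> (forall x, U x -> U' (f x)) ->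
  Ck k U f -> Ck k U' g -> Ck k U (g \o f).
Proof.
move=> oU oU' fU kf kg; have [n [e [p [cp pE]]]] := cZ.
have /choice[L LE] i := scalel_pack (e i).
apply: (@eq_Ck _ _ _ _ _ (fun x => \sum_(i < n) (L i \o (p i \o g \o f)) x)) => //.
  by move=> x _ /=; rewrite [RHS]pE; apply: eq_bigr => i _; rewrite (LE i).2.
apply: Ck_sum => // i; apply: Ck_linear_comp => //.
- exact: (LE i).1.
- exact: (Ck_compR oU oU' fU kf (Ck_linear_comp oU' (cp i) kg)).
Qed.

End ChainRule.

(** * Smooth maps on arbitrary subsets *)

Section SmoothCalculus.
Context {R : realType}.

Section Locality.
Context {V W : normedModType R}.
Implicit Types (A B : set V) (f g : V -> W).

Lemma eq_smooth_on A f g : {in A, f =1 g} -> smooth_on A f -> smooth_on A g.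
Proof.
move=> fg sf x Ax; have [U [h [oU Ux kh hf]]] := sf x Ax.
exists U, h; split=> // y /set_mem[Ay Uy].
by rewrite hf ?fg//; apply/mem_set.
Qed.

Lemma smooth_on_subset A B f : B `<=` A -> smooth_on A f -> smooth_on B f.
Proof.
move=> BA sf x Bx; have [U [h [oU Ux kh hf]]] := sf x (BA _ Bx).
exists U, h; split=> // y /set_mem[By Uy].
by apply: hf; apply/mem_set; split=> //; exact: BA.
Qed.

(** A neighbourhood relative to A is enough: this is how a chart of an
    intermediate point is brought in. *)
Lemma smooth_on_local A f :
  (forall x, A x -> exists2 B, within A (nbhs x) B & smooth_on (A `&` B) f) ->
  smooth_on A f.
Proof.
move=> loc x Ax; have [B] := loc x Ax.
rewrite /within nbhsE; case=> O [oO Ox] OB sf.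
have [U [h [oU Ux kh hf]]] := sf x (conj Ax (OB x Ox Ax)).
exists (U `&` O), h; split=> //; first exact: openI.
  by move=> k; apply: Ck_subset (kh k) => y [].
move=> y /set_mem[Ay [Uy Oy]]; apply: hf; apply/mem_set; split=> //.
by split=> //; exact: OB.
Qed.

Lemma smooth_on_linear A (L : {linear V -> W}) : continuous L -> smooth_on A L.
Proof.
move=> cL x _; exists setT, L; split=> //; first exact: openT.
by move=> k; exact: Ck_linear.
Qed.

Lemma smooth_on_const A (a : W) : smooth_on A (cst a : V -> W).
Proof.
move=> x _; exists setT, (cst a); split=> //; first exact: openT.
by move=> k; exact: Ck_const.
Qed.

Lemma smooth_on_add A f g : smooth_on A f -> smooth_on A g ->
  smooth_on A (f \+ g).
Proof.
move=> sf sg x Ax.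
have [U [f' [oU Ux kf ff']]] := sf x Ax.
have [U' [g' [oU' Ux' kg gg']]] := sg x Ax.
exists (U `&` U'), (f' \+ g'); split=> //; first exact: openI.
  move=> k; apply: Ck_add; first exact: openI.
    by apply: Ck_subset (kf k) => y [].
  by apply: Ck_subset (kg k) => y [].
by move=> y /set_mem [Ay [Uy U'y]] /=; rewrite ff' ?gg' //; apply/mem_set.
Qed.

End Locality.

Lemma smooth_on_comp (V W Z : normedModType R) (A : set V) (B : set W)
    (f : V -> W) (g : W -> Z) :
  has_coordinates W -> has_coordinates Z -> (forall x, A x -> B (f x)) ->
  smooth_on A f -> smooth_on B g -> smooth_on A (g \o f).
Proof.
move=> cW cZ AB sf sg x Ax.
have [U [f' [oU Ux kf ff']]] := sf x Ax.
have [U' [g' [oU' Ux' kg gg']]] := sg (f x) (AB x Ax).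
have f'x : f' x = f x by apply: ff'; apply/mem_set.
have cf : {in U, continuous f'}.
  by move=> y /set_mem Uy; exact: Ck_continuous (kf 0%N) Uy.
have oO : open (U `&` f' @^-1` U').
  rewrite openE => y [Uy U'y]; apply: filterI; first exact: open_nbhs_nbhs.
  by apply: (cf y (mem_set Uy)); exact: open_nbhs_nbhs.
exists (U `&` f' @^-1` U'), (g' \o f'); split=> //.
- by split=> //; rewrite /preimage/= f'x.
- move=> k; apply: (@Ck_comp _ _ _ _ cW cZ _ _ U') => //.
    by move=> y [].
  by apply: Ck_subset (kf k) => y [].
- move=> y /set_mem[Ay [Uy]]; rewrite /preimage/= => U'y.
  have f'y : f' y = f y by apply: ff'; apply/mem_set.
  by rewrite f'y gg' //; apply/mem_set; split; [exact: AB|rewrite -f'y].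
Qed.

Lemma smooth_on_pair (V W Z : normedModType R) (A : set V)
    (f : V -> W) (g : V -> Z) :
  has_coordinates W -> has_coordinates Z ->
  smooth_on A f -> smooth_on A g ->
  smooth_on A ((fun x => (f x, g x)) : V -> (W * Z)%type).
Proof.
move=> cW cZ sf sg.
have li : linear ((fun w => (w, 0)) : W -> (W * Z)%type).
  by move=> a u v; congr pair; rewrite /= ?scaler0 ?addr0.
have lj : linear ((fun w => (0, w)) : Z -> (W * Z)%type).
  by move=> a u v; congr pair; rewrite /= ?scaler0 ?addr0.
have [L LE] := linear_pack li; have [M ME] := linear_pack lj.
have cWZ := has_coordinates_prod cW cZ.
have sL : smooth_on setT L.
  apply: smooth_on_linear; rewrite LE => x.
  by apply: cvg_pair; [exact: cvg_id|exact: cvg_cst].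
have sM : smooth_on setT M.
  apply: smooth_on_linear; rewrite ME => x.
  by apply: cvg_pair; [exact: cvg_cst|exact: cvg_id].
apply: (@eq_smooth_on _ _ _ ((L \o f) \+ (M \o g))).
  by move=> x _ /=; rewrite LE ME; congr pair; rewrite /= ?addr0 ?add0r.
by apply: smooth_on_add; apply: (@smooth_on_comp _ _ _ _ setT).
Qed.

Lemma smooth_on_fst (V W : normedModType R) (A : set (V * W)) :
  smooth_on A (fst : (V * W)%type -> V).
Proof.
have lf : linear (fst : (V * W)%type -> V) by [].
by have [L LE] := linear_pack lf; rewrite -LE; apply: smooth_on_linear;
  rewrite LE => x; exact: cvg_fst.
Qed.

Lemma smooth_on_snd (V W : normedModType R) (A : set (V * W)) :
  smooth_on A (snd : (V * W)%type -> W).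
Proof.
have lf : linear (snd : (V * W)%type -> W) by [].
by have [L LE] := linear_pack lf; rewrite -LE; apply: smooth_on_linear;
  rewrite LE => x; exact: cvg_snd.
Qed.

Lemma smooth_on_id (V : normedModType R) (A : set V) :
  smooth_on A (id : V -> V).
Proof. by apply: (smooth_on_linear (L := idfun)) => x; exact: cvg_id. Qed.

End SmoothCalculus.

(** * A smooth function that is flat at the origin *)

Section FlatFunction.
Context {R : realType}.
Implicit Types (p : {poly R}) (x y : R).

(** The functions p(1/x) exp(1 - 1/x), extended by 0 to x <= 0: a class of
    smooth functions that is closed under differentiation. *)
Definition flat_exp p x : R := if 0 < x then p.[x^-1] * expR (1 - x^-1) else 0.

Definition flat_exp_deriv p : {poly R} := 'X^2 * (p - p^`()).

(** The exponential beats the polynomial: p(y) y^2 exp(-y) stays bounded, with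
    y = 1/x. The quadratic bound makes the derivative at 0 vanish. *)
Lemma flat_exp_bound p : exists2 K : R, 0 < K &
  forall x, x < 1 -> `|flat_exp p x| <= K * x ^+ 2.
Proof.
pose S := \sum_(i < size p) `|p`_i|; pose m := (size p).+1.
have S0 : 0 <= S by apply: sumr_ge0 => i _.
pose K := (S + 1) * m.+1`!%:R * expR 1.
have K0 : 0 < K.
  by rewrite !mulr_gt0 ?expR_gt0 ?ltr0n ?fact_gt0// ltr_wpDl.
exists K => // x x1; rewrite /flat_exp; case: ifPn => x0; last first.
  by rewrite normr0 mulr_ge0 ?sqr_ge0// ltW.
set y := x^-1; have y0 : 0 < y by rewrite invr_gt0.
have y1 : 1 <= y by rewrite invf_ge1 // ltW.
have py : `|p.[y]| <= S * y ^+ size p.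
  rewrite horner_coef (le_trans (ler_norm_sum _ _ _))// mulr_suml.
  apply: ler_sum => i _; rewrite normrM ler_wpM2l// ger0_norm ?(exprn_ge0 _ (ltW y0))//.
  exact: (ler_weXn2l y1 (ltnW (ltn_ord i))).
(* one term of the exponential series *)
have ey : y ^+ m.+1 <= m.+1`!%:R * expR y.
  have := @expR_ge1Dxn R y m (ltW y0).
  rewrite -ler_pdivrMl ?ltr0n ?fact_gt0// mulrC; apply: le_trans.
  by rewrite lerDr.
have xE : x = y^-1 by rewrite invrK.
rewrite xE exprVn ler_pdivlMr ?exprn_gt0// normrM.
rewrite (gtr0_norm (expR_gt0 _)) expRD expRN.
have -> : `|p.[y]| * (expR 1 / expR y) * y ^+ 2 =
  (`|p.[y]| * y ^+ 2) * expR 1 / expR y by ring.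
rewrite ler_pdivrMr ?expR_gt0//.
have -> : K * expR y = (S + 1) * (m.+1`!%:R * expR y) * expR 1 by rewrite /K; ring.
rewrite ler_wpM2r ?expR_ge0//.
apply: (@le_trans _ _ (S * y ^+ m.+1)).
  by rewrite /m -[(size p).+2]addn2 exprD [S * (_ * _)]mulrA ler_wpM2r ?(exprn_ge0 _ (ltW y0)).
apply: ler_pM => //; first by rewrite (exprn_ge0 _ (ltW y0)).
by rewrite lerDl.
Qed.

Lemma is_derive_flat_exp p x :
  is_derive x 1 (flat_exp p) (flat_exp (flat_exp_deriv p) x).
Proof.
have [x0|x0|->] := ltgtP x 0.
- rewrite {2}/flat_exp ltNge (ltW x0) /=.
  apply: near_eq_is_derive (is_derive_cst 0 x 1).
  near=> y; rewrite /flat_exp ltNge ifF//.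
  by apply/negbF/ltW; near: y; exact: lt_nbhsl.
- rewrite {2}/flat_exp x0 /flat_exp_deriv.
  apply: (@near_eq_is_derive _ _ _ (fun y => p.[y^-1] * expR (1 - y^-1))).
    near=> y; rewrite /flat_exp ifT//.
    by near: y; exact: lt_nbhsr.
  have x0' : x != 0 by rewrite gt_eqF.
  have dV : is_derive x 1 (fun y : R => y^-1) (- x ^- 2).
    by have := @is_deriveV _ id x 1 1 x0' (is_derive_id _ _);
      rewrite /GRing.scale/= mulr1.
  have dp : is_derive x 1 (fun y => p.[y^-1]) (p^`().[x^-1] * (- x ^- 2)).
    exact: (@is_derive1_comp _ (horner p) (fun y => y^-1)).
  have d1 : is_derive x 1 (fun y : R => 1 - y^-1) (x ^- 2).
    have := is_deriveB (is_derive_cst (1:R) x 1) dV.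
    by rewrite sub0r opprK.
  have de : is_derive x 1 (fun y => expR (1 - y^-1)) (expR (1 - x^-1) * x ^- 2).
    exact: (@is_derive1_comp _ expR (fun y => 1 - y^-1)).
  have := is_deriveM dp de.
  move=> /is_derive_eq; apply; rewrite /GRing.scale/= hornerM hornerXn hornerD hornerN exprVn; ring.
- rewrite {2}/flat_exp ltxx.
  have [K K0 fK] := flat_exp_bound p.
  suff H : (fun h : R => h^-1 *: (flat_exp p (h *: 1 + 0) - flat_exp p 0)) @ 0^' --> 0.
    by apply: DeriveDef; [apply/cvg_ex; exists 0|exact/cvg_lim].
  apply/cvgr0Pnorm_le => e e0; near=> h.
  have h0 : h != 0 by near: h; exact: nbhs_dnbhs_neq.
  have h1 : `|h| <= e / K.
    near: h; apply: dnbhs0_le; exact: divr_gt0.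
  have h2 : `|h| < 1 by near: h; exact: dnbhs0_lt.
  rewrite {2}/flat_exp ltxx subr0 addr0 /GRing.scale/= mulr1 normrM normfV.
  rewrite ler_pdivrMl ?normr_gt0//.
  apply: le_trans (fK h _) _; first by rewrite (le_lt_trans (ler_norm _)).
  rewrite -real_normK ?num_real// expr2 mulrCA ler_wpM2l//.
  by rewrite mulrC -ler_pdivlMr.
Unshelve. all: by end_near. Qed.

Lemma differentiable_flat_exp p x : differentiable (flat_exp p : R^o -> R^o) x.
Proof. by apply/derivable1_diffP; case: (is_derive_flat_exp p x). Qed.

(** Directional derivatives are again of the form flat_exp, so the induction
    runs over all polynomials at once. *)
Lemma Ck_flat_exp k U p : Ck k U (flat_exp p : R^o -> R^o).
Proof.
elim: k p => [|k IH] p.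
  by move=> x _; exact/differentiable_continuous/differentiable_flat_exp.
split=> [x _|v]; first exact: differentiable_flat_exp.
rewrite (_ : 'D_v _ = flat_exp (v *: flat_exp_deriv p)); first exact: IH.
apply/funext => x; rewrite deriveE; last exact: differentiable_flat_exp.
have -> : (v : R) = v *: (1 : R^o) by rewrite /GRing.scale/= mulr1.
rewrite linearZ /= -deriveE; last exact: differentiable_flat_exp.
have [_ ->] := is_derive_flat_exp p x.
rewrite /flat_exp; case: ifPn => _; last by rewrite scaler0.
by rewrite !hornerZ /GRing.scale/= mulr1 mulrA.
Qed.

(** The exponent 1 - 1/x, rather than -1/x, makes the value at 1 equal to 1. *)
Definition flat (x : R) : R := flat_exp 1 x.
Definition flat' (x : R) : R := flat_exp 'X^2 x.

Lemma is_derive_flat x : is_derive x 1 flat (flat' x).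
Proof.
by apply: is_derive_eq (is_derive_flat_exp 1 x) _; congr flat_exp;
  rewrite /flat_exp_deriv -polyC1 derivC subr0 mulr1.
Qed.

Lemma continuous_flat' : continuous flat'.
Proof. by move=> x; exact/differentiable_continuous/differentiable_flat_exp. Qed.

Lemma flat_le0 x : x <= 0 -> flat x = 0.
Proof. by rewrite /flat /flat_exp leNgt => /negbTE ->. Qed.

Lemma flat'_le0 x : x <= 0 -> flat' x = 0.
Proof. by rewrite /flat' /flat_exp leNgt => /negbTE ->. Qed.

Lemma flatE x : 0 < x -> flat x = expR (1 - x^-1).
Proof. by rewrite /flat /flat_exp => ->; rewrite hornerE mul1r. Qed.

Lemma flat'_gt0 x : 0 < x -> 0 < flat' x.
Proof.
rewrite /flat' /flat_exp => x0; rewrite x0 hornerXn mulr_gt0 ?expR_gt0//.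
by rewrite exprn_gt0 ?invr_gt0.
Qed.

Lemma flat'_ge0 x : 0 <= flat' x.
Proof. by have [/flat'_le0->|/flat'_gt0/ltW] := leP x 0. Qed.

Lemma flat_gt0 x : 0 < x -> 0 < flat x.
Proof. by move=> x0; rewrite flatE// expR_gt0. Qed.

Lemma flat_ge0 x : 0 <= flat x.
Proof. by have [/flat_le0->|/flat_gt0/ltW] := leP x 0. Qed.

Lemma flat1 : flat 1 = 1.
Proof. by rewrite flatE// invr1 subrr expR0. Qed.

Lemma flat_le1 x : x <= 1 -> flat x <= 1.
Proof.
have [x0 _|x0 x1] := leP x 0; first by rewrite flat_le0.
by rewrite flatE// expR_le1 subr_le0 invf_ge1.
Qed.

(** The inverse of flat on ]0, 1[, explicit so that its continuity is clear. *)
Definition flat_inv (y : R) : R := (1 - ln y)^-1.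

Lemma flat_inv_itv y : 0 < y < 1 -> 0 < flat_inv y < 1.
Proof.
move=> y01; have l0 := ln_lt0 y01.
have l1 : 1 < 1 - ln y by rewrite ltrDl oppr_gt0.
by rewrite /flat_inv invr_gt0 (lt_trans _ l1)//= invf_lt1// (lt_trans _ l1).
Qed.

Lemma flat_invK y : 0 < y < 1 -> flat (flat_inv y) = y.
Proof.
move=> y01; have /andP[k0 _] := flat_inv_itv y01; have /andP[y0 _] := y01.
by rewrite flatE// /flat_inv invrK opprB addrCA subrr addr0 lnK// posrE.
Qed.

Lemma flatK x : 0 < x -> flat_inv (flat x) = x.
Proof. by move=> x0; rewrite flatE// /flat_inv expRK opprB addrCA subrr addr0 invrK. Qed.

End FlatFunction.

(** * Smooth paths of maps of a manifold *)

Lemma within_comp (T U S : topologicalType) (A : set T) (B : set U)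
    (f : T -> U) (g : U -> S) :
  {within A, continuous f} -> {within B, continuous g} ->
  (forall x, A x -> B (f x)) -> {within A, continuous (g \o f)}.
Proof.
move=> /subspace_continuousP cf /subspace_continuousP cg AB.
apply/subspace_continuousP => x Ax P /(cg _ (AB x Ax)).
rewrite /nbhs/= /within/= => /(cf x Ax); rewrite /nbhs/= /within/=.
by apply: filterS => y BP Ay; apply: BP => //; exact: AB.
Qed.

Lemma within_pair (T U S : topologicalType) (A : set T)
    (f : T -> U) (g : T -> S) :
  {within A, continuous f} -> {within A, continuous g} ->
  {within A, continuous (fun x => (f x, g x))}.
Proof.
move=> /subspace_continuousP cf /subspace_continuousP cg.
by apply/subspace_continuousP => x Ax; apply: cvg_pair; [exact: cf|exact: cg].
Qed.

Lemma within_preimage (T S : topologicalType) (A : set T) (B : set S)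
    (f : T -> S) x :
  {within A, continuous f} -> open B -> A x -> B (f x) ->
  within A (nbhs x) (f @^-1` B).
Proof.
move=> /subspace_continuousP cf oB Ax Bfx.
by apply: (cf x Ax B); exact: open_nbhs_nbhs.
Qed.

Section ManifoldPaths.
Context {R : realType} (M : closedManifold R).
Implicit Types (c d e : chart R (Defs.dim M) M) (Psi Phi : R -> M -> M).

Let n := Defs.dim M.
Local Notation V := (R^o * 'rV[R]_n)%type.

Let cooR := @has_coordinates_R R.
Let coon := @has_coordinates_rV R n.
Let cooV : has_coordinates V := has_coordinates_prod cooR coon.

Lemma chart_img_dom c u : chart_img c u -> chart_dom c (chart_inv c u).
Proof. by move=> [x cx <-]; rewrite chart_mapK// inE. Qed.

Lemma chart_imgK c u : chart_img c u -> chart_map c (chart_inv c u) = u.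
Proof. by move=> [x cx <-]; rewrite chart_mapK// inE. Qed.

Lemma chart_img_map c x : chart_dom c x -> chart_img c (chart_map c x).
Proof. by move=> cx; exists x. Qed.

(** Times and coordinates at which a path can be read in a chart of its
    source, wherever its values lie. *)
Definition path_dom c : set V := [set p | 0 <= p.1 <= 1 /\ chart_img c p.2].

Lemma path_chart_continuous Psi c : smooth_path Psi ->
  {within path_dom c, continuous (fun p : V => Psi p.1 (chart_inv c p.2))}.
Proof.
move=> [cPsi _].
have cf : {within path_dom c, continuous (fun p : V => (p.1 : R, chart_inv c p.2))}.
  apply: within_pair; apply/subspace_continuousP => p [p01 cp].
    by apply: cvg_within_filter; exact: cvg_fst.
  apply: (@cvg_comp _ _ _ snd (chart_inv c) _ (nbhs p.2)).
    by apply: cvg_within_filter; exact: cvg_snd.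
  exact: chart_inv_cont.
have fA p : path_dom c p -> (`[0, 1] `*` setT) (p.1 : R, chart_inv c p.2).
  by move=> [p01 _]; split=> //=; rewrite in_itv.
exact: within_comp cf cPsi fA.
Qed.

(** Clocks for paths; a decreasing one serves to run a path backwards. *)
Definition smooth_time (r : R -> R) : Prop :=
  smooth_on setT (r : R^o -> R^o) /\ forall t, 0 <= t <= 1 -> 0 <= r t <= 1.

Lemma smooth_time_id : smooth_time id.
Proof. by split=> //; exact: smooth_on_id. Qed.

Lemma smooth_time_continuous r : smooth_time r -> continuous r.
Proof.
move=> [sr _] t; have [U [h [oU Ut kh hr]]] := sr t I.
have ch : {for t, continuous h} := Ck_continuous (kh 0%N) Ut.
have hrt : h t = r t by apply: hr; apply/mem_set.
rewrite /continuous_at -hrt; apply: cvg_trans ch; apply: near_eq_cvg.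
have := open_nbhs_nbhs (conj oU Ut); apply: filterS => y Uy.
by apply: hr; apply/mem_set.
Qed.

(** Near each of its points the inner path factors through a chart, and
    smoothness is local. The predicate D allows an outer map G that is defined
    on part of M only, such as a path read in a chart of its target. *)
Lemma smooth_path_factor (Z : normedModType R) Phi (r1 r2 : R -> R)
    (G : R -> M -> Z) (D : R -> M -> Prop) :
  has_coordinates Z -> smooth_path Phi -> smooth_time r1 -> smooth_time r2 ->
  (forall e, atlas M e ->
    smooth_on [set q : V | path_dom e q /\ D q.1 (chart_inv e q.2)]
      (fun q => G q.1 (chart_inv e q.2))) ->
  forall c, atlas M c ->
    smooth_on [set p : V | path_dom c p /\ D (r2 p.1) (Phi (r1 p.1) (chart_inv c p.2))]
      (fun p => G (r2 p.1) (Phi (r1 p.1) (chart_inv c p.2))).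
Proof.
move=> cZ sPhi sr1 sr2 sG c cM; apply: smooth_on_local => p [pc Dp].
have [e eM ep] := atlas_cover (Phi (r1 p.1) (chart_inv c p.2)).
pose k1 : V -> V := fun p => (r1 p.1, p.2).
have sk1 A : smooth_on A k1.
  apply: smooth_on_pair => //; last exact: smooth_on_snd.
  apply: (@smooth_on_comp _ _ _ _ _ setT _ (r1 : R^o -> R^o)) sr1.1 => //.
  exact: smooth_on_fst.
exists [set p : V | chart_dom e (Phi (r1 p.1) (chart_inv c p.2))].
  have ck1 : {within path_dom c, continuous k1}.
    apply: within_pair; apply/subspace_continuousP => q _.
      apply: (@cvg_comp _ _ _ fst r1 _ (nbhs q.1)).
        by apply: cvg_within_filter; exact: cvg_fst.
      exact: smooth_time_continuous.
    by apply: cvg_within_filter; exact: cvg_snd.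
  have := @within_preimage _ _ _ _ _ p (within_comp ck1 (path_chart_continuous (c := c) sPhi) _)
    (chart_dom_open e) pc ep.
  move=> H; have {}H := H (fun q qc => conj (sr1.2 _ qc.1) qc.2).
  by move: H; rewrite /within/=; apply: filterS => q qe [/qe].
pose B := [set q : V | path_dom c q /\ chart_dom e (Phi (r1 q.1) (chart_inv c q.2))].
pose k : V -> V := fun q => (r2 q.1, chart_map e (Phi (r1 q.1) (chart_inv c q.2))).
have sk : smooth_on B k.
  apply: smooth_on_pair => //.
    apply: (@smooth_on_comp _ _ _ _ _ setT _ (r2 : R^o -> R^o)) sr2.1 => //.
    exact: smooth_on_fst.
  apply: (@smooth_on_comp _ _ _ _ _ _ k1) (sPhi.2 c e cM eM) => //.
  by move=> q [[q01 qc] qe]; split=> //; exact: sr1.2.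
apply: (@eq_smooth_on _ _ _ _ ((fun q : V => G q.1 (chart_inv e q.2)) \o k)).
  by move=> q /set_mem[_ qe] /=; rewrite chart_mapK// inE.
apply: smooth_on_comp (sG e eM) => //; last first.
  by apply: smooth_on_subset sk => q [[]].
move=> q [[[q01 qc] Dq] qe]; split; last by rewrite /= chart_mapK// inE.
by split; [exact: sr2.2|exact: chart_img_map].
Qed.

Lemma smooth_path_comp Psi Phi r1 r2 :
  smooth_path Psi -> smooth_path Phi -> smooth_time r1 -> smooth_time r2 ->
  smooth_path (fun t => Psi (r2 t) \o Phi (r1 t)).
Proof.
move=> sPsi sPhi sr1 sr2; split.
  have cr r : smooth_time r ->
      {within `[0, 1] `*` setT, continuous ((fun p => (r p.1)) : R * M -> R)}.
    move=> sr; apply/subspace_continuousP => q _.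
    apply: (@cvg_comp _ _ _ fst r _ (nbhs q.1)).
      by apply: cvg_within_filter; exact: cvg_fst.
    exact: smooth_time_continuous.
  have r01 r (p : R * M) (x : M) : smooth_time r -> (`[0, 1] `*` setT) p ->
      (`[0, 1] `*` setT) (r p.1, x).
    by move=> sr [/= + _]; rewrite !in_itv/= => /sr.2.
  have c2 : {within `[0, 1] `*` setT, continuous (snd : R * M -> M)}.
    by apply/subspace_continuousP => q _; apply: cvg_within_filter; exact: cvg_snd.
  apply: (within_comp (within_pair (cr _ sr2)
    (within_comp (within_pair (cr _ sr1) c2) sPhi.1 _)) sPsi.1).
    by move=> p; exact: r01.
  by move=> p; exact: r01.
move=> c d cM dM.
apply: smooth_on_subset (smooth_path_factor (G := fun t x => chart_map d (Psi t x))
  (D := fun t x => chart_dom d (Psi t x)) coon sPhi sr1 sr2 _ cM).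
  by move=> p [].
move=> e eM; apply: smooth_on_subset (sPsi.2 e d eM dM).
by move=> q [[? ?] ?]; split.
Qed.

Lemma smooth_path_cst (h : M -> M) : smooth_map h -> smooth_path (fun=> h).
Proof.
move=> [ch sh]; split.
  apply/subspace_continuousP => q _; apply: (@cvg_comp _ _ _ snd h _ (nbhs q.2)).
    by apply: cvg_within_filter; exact: cvg_snd.
  exact: ch.
move=> c d cM dM.
apply: (@smooth_on_comp _ _ _ _ _ _ snd) (sh c d cM dM) => //; last exact: smooth_on_snd.
move=> p [_ cp dp]; exists (chart_inv c p.2); last exact: chart_imgK.
by split=> //; exact: chart_img_dom.
Qed.

(** Properties of a single map, or of the trajectory of a point, follow from
    those of a path by composing with an affine inclusion. *)
Lemma smooth_freeze_time (Z : normedModType R) (A : set V) (F : V -> Z) (t : R) :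
  has_coordinates Z -> smooth_on A F ->
  smooth_on [set u | A (t, u)] (fun u => F (t, u)).
Proof.
move=> cZ sF; apply: (@smooth_on_comp _ _ _ _ _ _ (fun u => (t, u))) sF => //.
by apply: smooth_on_pair => //; [exact: smooth_on_const|exact: smooth_on_id].
Qed.

Lemma smooth_freeze_space (Z : normedModType R) (A : set V) (F : V -> Z) u :
  has_coordinates Z -> smooth_on A F ->
  smooth_on [set t | A (t, u)] (fun t => F (t, u)).
Proof.
move=> cZ sF; apply: (@smooth_on_comp _ _ _ _ _ _ (fun t => (t, u))) sF => //.
by apply: smooth_on_pair => //; [exact: smooth_on_id|exact: smooth_on_const].
Qed.

Lemma smooth_path_at Psi t : smooth_path Psi -> 0 <= t <= 1 -> smooth_map (Psi t).
Proof.
move=> [cPsi sPsi] t01; split.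
  apply/continuous_subspace_setT.
  apply: (@within_comp _ _ _ _ _ (fun x => (t, x))) cPsi _.
    by apply: within_pair; apply: continuous_subspaceT => x; [exact: cvg_cst|exact: cvg_id].
  by move=> x _; split=> //=; rewrite in_itv.
move=> c d cM dM.
have S := smooth_freeze_time (t := t) coon (sPsi c d cM dM).
apply: (smooth_on_subset _ S) => _ [x [cx dx] <-].
by split=> //=; [exact: chart_img_map|rewrite chart_mapK// inE].
Qed.

Lemma smooth_map_comp (h k : M -> M) : smooth_map h -> smooth_map k ->
  smooth_map (h \o k).
Proof.
move=> sh sk; apply: (@smooth_path_at (fun=> h \o k) 0); last by rewrite lexx ler01.
exact: (smooth_path_comp (smooth_path_cst sh) (smooth_path_cst sk)
  smooth_time_id smooth_time_id).
Qed.

Lemma smooth_map_id : smooth_map (id : M -> M).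
Proof.
split; first by move=> x; exact: cvg_id.
move=> c d cM dM; apply: smooth_on_subset (atlas_compat cM dM).
by move=> _ [x ? <-]; exists x.
Qed.

Lemma smooth_fun_path (f : M -> R^o) Psi c : f \in smooth_fun (M := M) -> smooth_path Psi ->
  atlas M c -> smooth_on (path_dom c) (fun p : V => f (Psi p.1 (chart_inv c p.2)) : R^o).
Proof.
move=> /asboolP sf sPsi cM.
apply: smooth_on_subset (smooth_path_factor (G := fun _ x => f x)
  (D := fun _ _ => True) cooR sPsi smooth_time_id smooth_time_id _ cM) => // e eM.
apply: (@smooth_on_comp _ _ _ _ _ (chart_img e) snd (f \o chart_inv e)) (sf e eM) => //.
  by move=> q [[]].
exact: smooth_on_snd.
Qed.

Lemma smooth_fun_comp (f : M -> R^o) (h : M -> M) : f \in smooth_fun (M := M) -> smooth_map h ->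
  (f \o h : M -> R^o) \in smooth_fun (M := M).
Proof.
move=> sf sh; apply/asboolP => c cM.
apply: smooth_on_subset (smooth_freeze_time (t := 0) cooR
  (smooth_fun_path sf (smooth_path_cst sh) cM)) => u cu.
by split=> //=; rewrite lexx ler01.
Qed.

Lemma smooth_fun_time (f : M -> R^o) Psi x : f \in smooth_fun (M := M) -> smooth_path Psi ->
  smooth_on [set t : R^o | 0 <= t <= 1] ((fun t : R^o => f (Psi t x)) : R^o -> R^o).
Proof.
move=> sf sPsi; have [c cM cx] := atlas_cover x.
have := smooth_freeze_space (u := chart_map c x) cooR (smooth_fun_path sf sPsi cM).
rewrite /= chart_mapK ?inE//; apply: smooth_on_subset => t t01.
by split=> //; exact: chart_img_map.
Qed.

End ManifoldPaths.

(** * Pushforward of vector fields and symplectomorphisms *)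

Section Pushforward.
Context {R : realType} {M : closedManifold R}.
Implicit Types (h k : M -> M) (X Y Z : VF M) (f : Cinf M).

Lemma Cinf_ext f f' : (forall x, f x = f' x) -> f = f'.
Proof. by move=> ff'; apply/val_inj/funext. Qed.

Lemma VF_ext X Y : (forall f x, X f x = Y f x) -> X = Y.
Proof. by move=> XY; apply/val_inj/funext => f; apply: Cinf_ext => x; exact: XY. Qed.

Definition pullback h (sh : smooth_map h) f : Cinf M :=
  MkCinf (smooth_fun_comp (valP f) sh).

Section Pair.
Variables (h k : M -> M) (sh : smooth_map h) (sk : smooth_map k).
Hypothesis kK : cancel k h.

Lemma pushforward_subproof X :
  (fun f => pullback sk (X (pullback sh f)) : (Cinf M)^o) \in derivation (M := M).
Proof.
have [lX mX] := VF_derivation X.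
apply/asboolP; split=> [a f f'|f f'].
  have -> : pullback sh (a *: f + f') = a *: pullback sh f + pullback sh f'.
    exact: Cinf_ext.
  by rewrite lX; exact: Cinf_ext.
have -> : pullback sh (f * f') = pullback sh f * pullback sh f' by exact: Cinf_ext.
rewrite mX; apply: Cinf_ext => x /=.
rewrite -[LHS]/(f (h (k x)) * X (pullback sh f') (k x) +
  f' (h (k x)) * X (pullback sh f) (k x)) kK //.
Qed.

Definition pushforward X : VF M := MkVF (pushforward_subproof X).

Lemma pushforward_related X : cancel h k -> related h X (pushforward X).
Proof.
move=> hK f f' ff'.
have -> : f' = pullback sh f by exact: Cinf_ext.
by move=> x; rewrite -[RHS]/(X (pullback sh f) (k (h x))) hK.
Qed.

End Pair.

Lemma related_inv h k X Y : smooth_map h -> cancel h k -> cancel k h ->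
  related k X Y -> related h Y X.
Proof.
move=> sh hK kK kXY f f' ff' x.
rewrite (kXY f' f); last by move=> y; rewrite ff' kK.
by rewrite hK.
Qed.

(** The definition of a symplectomorphism speaks of related fields only, so a
    relation along a composition is split at the pushforward. *)
Lemma related_comp_inv h k1 k2 X Z : smooth_map k1 -> smooth_map k2 ->
  cancel k1 k2 -> cancel k2 k1 -> related (h \o k1) X Z ->
  exists2 Y, related k1 X Y & related h Y Z.
Proof.
move=> s1 s2 K1 K2 hXZ; exists (pushforward s1 s2 K2 X).
  exact: pushforward_related.
move=> f f' ff' y; rewrite -[LHS]/(X (pullback s1 f') (k2 y)).
by rewrite (hXZ f (pullback s1 f'))/= ?K2// => x /=; rewrite ff'.
Qed.

Lemma scale_VFE f X f' x : (f *: X) f' x = f x * X f' x.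
Proof. by []. Qed.

(** Vector fields form a module over the functions, and a real number acts on
    them through the corresponding constant. *)
Definition cst_fun (a : R) : Cinf M := a *: (1 : Cinf M).

Lemma cst_funE a x : cst_fun a x = a.
Proof. by rewrite -[LHS]/(a * 1) mulr1. Qed.

End Pushforward.

Section Symplectomorphisms.
Context {R : realType} {M : closedManifold R} (omega : VF M -> VF M -> Cinf M).
Implicit Types (h k : M -> M).

Lemma diffeomorphism_id : diffeomorphism (id : M -> M).
Proof. by split; [exact: smooth_map_id|exists id; split=> //; exact: smooth_map_id]. Qed.

Lemma diffeomorphism_comp h k : diffeomorphism h -> diffeomorphism k ->
  diffeomorphism (h \o k).
Proof.
move=> [sh [h' [sh' hK h'K]]] [sk [k' [sk' kK k'K]]].
split; first exact: smooth_map_comp.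
exists (k' \o h'); split; first exact: smooth_map_comp.
  exact: can_comp.
exact: can_comp.
Qed.

Lemma symplectomorphism_id : symplectomorphism omega id.
Proof.
split; first exact: diffeomorphism_id.
move=> X X' Y Y' XX' YY' x.
have idE (Z Z' : VF M) : related id Z Z' -> Z = Z'.
  by move=> ZZ'; apply: VF_ext => f y; exact: (ZZ' f f).
by rewrite (idE _ _ XX') (idE _ _ YY').
Qed.

Lemma symplectomorphism_comp h k :
  symplectomorphism omega h -> symplectomorphism omega k ->
  symplectomorphism omega (h \o k).
Proof.
move=> [dh oh] [dk ok]; split; first exact: diffeomorphism_comp.
have [sk [k' [sk' kK k'K]]] := dk; have [sh _] := dh.
move=> X X' Y Y' /(related_comp_inv sk sk' kK k'K)[Z XZ ZX'].
move=> /(related_comp_inv sk sk' kK k'K)[T YT TY'] x.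
by rewrite (ok _ _ _ _ XZ YT) (oh _ _ _ _ ZX' TY').
Qed.

Lemma symplectomorphism_inv h k : symplectomorphism omega h ->
  cancel h k -> cancel k h -> symplectomorphism omega k.
Proof.
move=> [[sh [k' [sk' hK' k'K]]] oh] hK kK.
have kE : k' = k by apply/funext => x; rewrite -[in LHS](kK x) hK'.
move: sk' hK' k'K; rewrite kE => sk _ _.
split; first by split=> //; exists h.
move=> X X' Y Y' /(related_inv sh hK kK) XX' /(related_inv sh hK kK) YY' x.
by rewrite (oh _ _ _ _ XX' YY') kK.
Qed.

Lemma inv_mapK h : diffeomorphism h -> cancel h (inv_map h) /\ cancel (inv_map h) h.
Proof.
move=> [_ [k [_ hK kK]]].
have K2 : cancel (inv_map h) h.
  move=> y; have /= := @xgetPex _ y [set x | h x = y]; apply.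
  by exists (k y).
split=> // x; apply: (can_inj hK); exact: K2.
Qed.

End Symplectomorphisms.

(** * Derivatives in time on the unit interval *)

Section Velocity.
Context {R : realType}.
Implicit Types (t d : R) (u v phi : R -> R).

(** One-sided derivatives at the ends of [0, 1], expressed by a derivable
    extension so that the chain rule applies. *)
Definition unit_derive u t d : Prop := exists2 phi : R -> R, is_derive t 1 phi d &
  \forall s \near t, 0 <= s <= 1 -> phi s = u s.

Lemma unit_derive_ext u v t d : (forall s, 0 <= s <= 1 -> u s = v s) ->
  unit_derive u t d -> unit_derive v t d.
Proof.
move=> uv [phi dphi phiu]; exists phi => //.
by apply: filterS phiu => s su s01; rewrite su// uv.
Qed.

Lemma unit_derive_cst a t : unit_derive (cst a) t 0.
Proof. exists (cst a); first exact: is_derive_cst.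
by near=> s.
Unshelve. all: by end_near. Qed.

Lemma unit_deriveD u v t d d' : unit_derive u t d -> unit_derive v t d' ->
  unit_derive (fun s => u s + v s) t (d + d').
Proof.
move=> [phi dphi phiu] [psi dpsi psiv]; exists (phi \+ psi).
  exact: is_deriveD.
by apply: filterS2 phiu psiv => s su sv s01; rewrite /= su// sv.
Qed.

Lemma unit_derive_comp u r t d a : unit_derive u (r t) d -> is_derive t 1 r a ->
  (forall s, 0 <= s <= 1 -> 0 <= r s <= 1) -> unit_derive (u \o r) t (d * a).
Proof.
move=> [phi dphi phiu] dr r01; exists (phi \o r).
  exact: is_derive1_comp.
have cr : {for t, continuous r}.
  have [/derivable1_diffP dr' _] := dr; exact: (differentiable_continuous dr').
have : nbhs t (r @^-1` [set s | 0 <= s <= 1 -> phi s = u s]) by exact: cr _ phiu.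
by apply: filterS => s /= H s01; apply: H; exact: r01.
Qed.

Lemma unit_derive_smooth u t : 0 <= t <= 1 ->
  smooth_on [set t : R^o | 0 <= t <= 1] (u : R^o -> R^o) -> exists d, unit_derive u t d.
Proof.
move=> t01 su; have [U [phi [oU Ut kphi phiu]]] := su t t01.
have [dphi _] := kphi 1%N; exists ('D_1 phi t), phi.
  by apply: DeriveDef => //; apply/derivable1_diffP; exact: dphi.
have := open_nbhs_nbhs (conj oU Ut); apply: filterS => s Us s01.
by apply: phiu; apply/mem_set.
Qed.

(** The limit that defines the velocity of a path. *)
Definition rate u t d : Prop :=
  (s - t)^-1 * (u s - u t) @[s --> within `[0, 1] t^'] --> d.

(** The two notions agree for smooth functions. The extension gives the chain
    rule, the limit gives uniqueness at the ends of [0, 1]. *)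
Lemma unit_derive_rate u t d : 0 <= t <= 1 -> unit_derive u t d -> rate u t d.
Proof.
move=> t01 [phi [dphi <-] phiu].
have phit : phi t = u t := nbhs_singleton phiu t01.
have := dphi => /[dup] /cvg_ex[/= l] ldphi _.
have -> : 'D_1 phi t = l by apply/cvg_lim.
apply/cvgrPdist_lt => e e0; have /cvgrPdist_lt/(_ e e0) := ldphi.
rewrite /dnbhs near_withinE => H.
rewrite near_withinE /dnbhs near_withinE.
have {}H : \forall s \near t, s - t != 0 ->
    `|l - (s - t)^-1 *: (phi ((s - t) *: 1 + t) - phi t)| < e.
  have ct : (fun s => s - t) @ t --> (0 : R).
    by rewrite -(subrr t); apply: cvgB; [exact: cvg_id|exact: cvg_cst].
  have {}ct : nbhs t ((fun s => s - t) @^-1` _) := ct _ H.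
  by apply: filterS ct => s /= Hs st; exact: Hs.
apply: filterS2 H phiu => s H su st s01.
rewrite -phit -su; last by move: s01; rewrite /= in_itv.
have := H _; rewrite /GRing.scale/= mulr1 subrK; apply.
by rewrite subr_eq0.
Qed.

Lemma rate_unique u t d d' : 0 <= t <= 1 -> rate u t d -> rate u t d' -> d = d'.
Proof.
move=> /andP[t0 t1] rd rd'.
have [F FF Fsub] : exists2 F : set_system R, ProperFilter F & F --> within `[0, 1] t^'.
  have [lt1|le1] := ltP t 1.
    exists (t^'+); first exact: at_right_proper_filter.
    move=> P PH; suff : nbhs t [set s | t < s -> P s] by [].
    have H : nbhs t [set s | s != t -> `[0, 1]%classic s -> P s] := PH.
    apply: filterS2 H (@lt_nbhsl R _ _ lt1) => s H s1 ts.
    apply: H; first by rewrite gt_eqF.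
    by rewrite /= in_itv/= (le_trans t0 (ltW ts)) ltW.
  have t1E : 0 < t by rewrite (lt_le_trans ltr01).
  exists (t^'-); first exact: at_left_proper_filter.
  move=> P PH; suff : nbhs t [set s | s < t -> P s] by [].
  have H : nbhs t [set s | s != t -> `[0, 1]%classic s -> P s] := PH.
  apply: filterS2 H (@lt_nbhsr R _ _ t1E) => s H s0 ts.
  apply: H; first by rewrite lt_eqF.
  by rewrite /= in_itv/= (ltW s0)/= (le_trans (ltW ts)).
exact: (cvg_unique _ (cvg_trans (cvg_app _ Fsub) rd) (cvg_trans (cvg_app _ Fsub) rd')).
Qed.
End Velocity.

(** * Velocities of paths and of concatenations *)

Section PathVelocity.
Context {R : realType} {M : closedManifold R}.
Implicit Types (Psi Phi : R -> M -> M) (X Y : VF M).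

Lemma unit_derive_unique (u : R -> R) t d d' : 0 <= t <= 1 ->
  unit_derive u t d -> unit_derive u t d' -> d = d'.
Proof.
by move=> t01 /(unit_derive_rate t01) ud /(unit_derive_rate t01); exact: rate_unique.
Qed.

(** The set whose chosen element is the velocity, in terms of extensions. *)
Definition is_velocity Psi t X : Prop := forall (f : Cinf M) x,
  unit_derive (fun s => f (Psi s x)) t (X f (Psi t x)).

Lemma path_unit_derive Psi t (f : Cinf M) x : smooth_path Psi -> 0 <= t <= 1 ->
  exists d, unit_derive (fun s => f (Psi s x)) t d.
Proof.
by move=> sPsi t01; apply: unit_derive_smooth => //; exact: smooth_fun_time (valP f) sPsi.
Qed.

Lemma velocity_spec Psi t X : smooth_path Psi -> 0 <= t <= 1 ->
  is_velocity Psi t X <->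
  forall (f : Cinf M) x, rate (fun s => f (Psi s x)) t (X f (Psi t x)).
Proof.
move=> sPsi t01; split=> H f x; first exact: unit_derive_rate.
have [d ud] := path_unit_derive f x sPsi t01.
by rewrite (rate_unique t01 (H f x) (unit_derive_rate t01 ud)).
Qed.

Lemma velocityE Psi t X : smooth_path Psi -> 0 <= t <= 1 ->
  (forall y, exists x, Psi t x = y) -> is_velocity Psi t X -> velocity Psi t = X.
Proof.
move=> sPsi t01 surj vX.
have /(velocity_spec _ sPsi t01) := vX => H.
have vV : is_velocity Psi t (velocity Psi t).
  apply/(velocity_spec (velocity Psi t) sPsi t01).
  exact: (@xgetI _ 0 [set X : VF M | forall (f : Cinf M) x,
    rate (fun s => f (Psi s x)) t (X f (Psi t x))] X H).
apply: VF_ext => f y; have [x <-] := surj y.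
exact: unit_derive_unique t01 (vV f x) (vX f x).
Qed.

Lemma velocity_none Psi t : smooth_path Psi -> 0 <= t <= 1 ->
  (forall X, ~ is_velocity Psi t X) -> velocity Psi t = 0.
Proof.
move=> sPsi t01 nX; apply: xgetPN => X.
by move=> H; exact: (nX X ((velocity_spec X sPsi t01).2 H)).
Qed.

(** When neither path has a velocity both sides are 0, the default value, so
    the existence of velocity fields does not have to be settled. *)
Lemma velocity_transport Psi Phi s t (T : VF M -> VF M) :
  smooth_path Psi -> smooth_path Phi -> 0 <= s <= 1 -> 0 <= t <= 1 ->
  (forall y, exists x, Psi s x = y) -> (forall y, exists x, Phi t x = y) ->
  T 0 = 0 ->
  (forall X, is_velocity Phi t X -> is_velocity Psi s (T X)) ->
  (forall Y, is_velocity Psi s Y -> exists X, is_velocity Phi t X) ->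
  velocity Psi s = T (velocity Phi t).
Proof.
move=> sPsi sPhi s01 t01 surjs surjt T0 PhiPsi PsiPhi.
have [[X vX]|nX] := pselect (exists X, is_velocity Phi t X).
  by rewrite (velocityE sPhi t01 surjt vX) (velocityE sPsi s01 surjs (PhiPsi _ vX)).
rewrite (velocity_none sPhi t01) ?T0; last by move=> X vX; apply: nX; exists X.
by apply: velocity_none => // Y /PsiPhi.
Qed.

End PathVelocity.

(** Time changes that let one path run on [0, 1/2] and another on [1/2, 1],
    both with all derivatives zero at 1/2. *)
Section Concatenation.
Context {R : realType}.
Implicit Types (t : R).

Definition time1 t : R := 1 - flat (1 - 2 * t).
Definition time2 t : R := flat (2 * t - 1).
Definition time1' t : R := 2 * flat' (1 - 2 * t).
Definition time2' t : R := 2 * flat' (2 * t - 1).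

Lemma smooth_flat_affine (a b : R) :
  smooth_on setT ((fun t => flat (a * t + b)) : R^o -> R^o).
Proof.
apply: (@smooth_on_comp _ _ _ _ _ setT (fun t : R^o => (a * t + b : R^o)) flat) => //.
- exact: has_coordinates_R.
- exact: has_coordinates_R.
- apply: (smooth_onD (f := fun t : R^o => (a * t : R^o)) (g := cst b));
    last exact: smooth_on_cst.
  apply: (smooth_onM (f := cst a) (g := id)); first exact: smooth_on_cst.
  exact: smooth_on_id.
- move=> x _; exists setT, flat; split=> //; first exact: openT.
  by move=> k; exact: Ck_flat_exp.
Qed.

Lemma smooth_time1 : smooth_time time1.
Proof.
split=> [|t /andP[t0 t1]].
  apply: (@eq_smooth_on _ _ _ _ (fun t : R^o =>
      (1 + (-1) * flat ((- 2) * t + 1) : R^o))).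
    by move=> t _; rewrite /time1 mulN1r mulNr [- _ + _]addrC.
  apply: (smooth_onD (f := cst 1)); first exact: smooth_on_cst.
  apply: (smooth_onM (f := cst (-1))); first exact: smooth_on_cst.
  exact: smooth_flat_affine.
rewrite /time1 subr_ge0 flat_le1; last by lra.
by rewrite gerBl flat_ge0.
Qed.

Lemma smooth_time2 : smooth_time time2.
Proof.
split=> [|t /andP[t0 t1]]; first exact: smooth_flat_affine.
by rewrite /time2 flat_ge0 flat_le1//; lra.
Qed.

Lemma is_derive_affine (a b t : R) : is_derive t 1 (fun t : R => a * t + b) a.
Proof.
have := is_deriveD (is_deriveZ a (is_derive_id t (1 : R))) (is_derive_cst b t (1 : R)).
by rewrite /GRing.scale/= mulr1 addr0.
Qed.

Lemma is_derive_time1 t : is_derive t 1 time1 (time1' t).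
Proof.
have d1 : is_derive t 1 (fun t => flat ((-2) * t + 1)) (flat' ((-2) * t + 1) * (-2)).
  by apply: (@is_derive1_comp _ flat (fun t => (-2) * t + 1));
    [exact: is_derive_flat|exact: is_derive_affine].
have := is_deriveB (is_derive_cst (1 : R) t 1) d1.
rewrite sub0r mulrN opprK mulrC.
rewrite (_ : cst 1 - _ = time1); last first.
  by apply/funext => s; rewrite /time1 !fctE mulNr [- _ + _]addrC.
by rewrite /time1' mulNr [- _ + _]addrC.
Qed.

Lemma is_derive_time2 t : is_derive t 1 time2 (time2' t).
Proof.
by rewrite /time2' mulrC; apply: (@is_derive1_comp _ flat (fun t => 2 * t - 1));
  [exact: is_derive_flat|exact: is_derive_affine].
Qed.

Lemma time1_end t : 1 / 2 <= t -> time1 t = 1.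
Proof. by move=> t2; rewrite /time1 flat_le0 ?subr0//; lra. Qed.

Lemma time2_start t : t <= 1 / 2 -> time2 t = 0.
Proof. by move=> t2; rewrite /time2 flat_le0//; lra. Qed.

Lemma time1'_end t : 1 / 2 <= t -> time1' t = 0.
Proof. by move=> t2; rewrite /time1' flat'_le0 ?mulr0//; lra. Qed.

Lemma time2'_start t : t <= 1 / 2 -> time2' t = 0.
Proof. by move=> t2; rewrite /time2' flat'_le0 ?mulr0//; lra. Qed.

Lemma time1'_gt0 t : t < 1 / 2 -> 0 < time1' t.
Proof. by move=> t2; rewrite mulr_gt0// flat'_gt0//; lra. Qed.

Lemma time2'_gt0 t : 1 / 2 < t -> 0 < time2' t.
Proof. by move=> t2; rewrite mulr_gt0// flat'_gt0//; lra. Qed.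

Lemma time1_0 : time1 0 = 0.
Proof. by rewrite /time1 mulr0 subr0 flat1 subrr. Qed.

Lemma time2_1 : time2 1 = 1.
Proof. by rewrite /time2 (_ : 2 * 1 - 1 = 1) ?flat1//; ring. Qed.

Context {M : closedManifold R}.
Implicit Types (Psi Phi : R -> M -> M) (X Y : VF M).

(** Composing instead of gluing: at each time one of the two factors is at rest,
    so this is the concatenation, and its smoothness at 1/2 is automatic. *)
Definition concat Psi Phi t : M -> M := Psi (time2 t) \o Phi (time1 t).

Section Pair.
Variables (Psi Phi : R -> M -> M).
Hypotheses (sPsi : smooth_path Psi) (sPhi : smooth_path Phi).
Hypotheses (Psi0 : Psi 0 = id) (Phi0 : Phi 0 = id).
Hypothesis surjPsi : forall t, 0 <= t <= 1 -> forall y, exists x, Psi t x = y.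
Hypothesis surjPhi : forall t, 0 <= t <= 1 -> forall y, exists x, Phi t x = y.

Lemma smooth_concat : smooth_path (concat Psi Phi).
Proof. exact: smooth_path_comp sPsi sPhi smooth_time1 smooth_time2. Qed.

Lemma concat0 : concat Psi Phi 0 = id.
Proof. by rewrite /concat time1_0 Phi0 time2_start ?Psi0//; lra. Qed.

Lemma concat1 : concat Psi Phi 1 = Psi 1 \o Phi 1.
Proof. by rewrite /concat time2_1 time1_end//; lra. Qed.

Lemma concat_left t : t <= 1 / 2 -> concat Psi Phi t = Phi (time1 t).
Proof. by move=> t2; rewrite /concat time2_start// Psi0. Qed.

Lemma concat_right t : 1 / 2 <= t -> concat Psi Phi t = Psi (time2 t) \o Phi 1.
Proof. by move=> t2; rewrite /concat time1_end. Qed.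

Lemma concat_surj t : 0 <= t <= 1 -> forall y, exists x, concat Psi Phi t x = y.
Proof.
move=> t01 y; have [z <-] := surjPsi (smooth_time2.2 _ t01) y.
by have [x <-] := surjPhi (smooth_time1.2 _ t01) z; exists x.
Qed.

(** As one of the factors is at rest at each time, f along the concatenation is,
    up to a constant, the sum of f along the two slowed trajectories. *)
Lemma concat_unit_derive (f : Cinf M) x t d1 d2 :
  unit_derive (fun s => f (Phi s x)) (time1 t) d1 ->
  unit_derive (fun s => f (Psi s (Phi 1 x))) (time2 t) d2 ->
  unit_derive (fun s => f (concat Psi Phi s x)) t (d1 * time1' t + d2 * time2' t).
Proof.
move=> u1 u2; have v1 := unit_derive_comp u1 (is_derive_time1 t) smooth_time1.2.
have v2 := unit_derive_comp u2 (is_derive_time2 t) smooth_time2.2.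
have := unit_deriveD (unit_deriveD v1 v2) (unit_derive_cst (- f (Phi 1 x)) t).
rewrite addr0; apply: unit_derive_ext => s _ /=.
have [s2|/ltW s2] := leP s (1 / 2).
  by rewrite concat_left// time2_start// Psi0 addrK.
by rewrite concat_right// time1_end//= addrAC subrr add0r.
Qed.

Lemma concat_velocity_left t : 0 <= t -> t < 1 / 2 ->
  velocity (concat Psi Phi) t = cst_fun (time1' t) *: velocity Phi (time1 t).
Proof.
move=> t0 t2; have t01 : 0 <= t <= 1 by lra.
have a0 := time1'_gt0 t2; have r1 := smooth_time1.2 _ t01.
apply: (@velocity_transport _ _ _ _ _ _ (fun X => cst_fun (time1' t) *: X)) => //.
- exact: smooth_concat.
- exact: concat_surj.
- exact: surjPhi.
- by rewrite scaler0.
- move=> X vX f x; have [d2 u2] := path_unit_derive f (Phi 1 x) sPsi (smooth_time2.2 _ t01).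
  have := concat_unit_derive (vX f x) u2.
  rewrite time2'_start ?(ltW t2)// mulr0 addr0 concat_left ?(ltW t2)//.
  by rewrite scale_VFE cst_funE mulrC.
- move=> Y vY; exists (cst_fun (time1' t)^-1 *: Y) => f x.
  have [d2 u2] := path_unit_derive f (Phi 1 x) sPsi (smooth_time2.2 _ t01).
  have [d1 u1] := path_unit_derive f x sPhi r1.
  have := unit_derive_unique t01 (concat_unit_derive u1 u2) (vY f x).
  rewrite time2'_start ?(ltW t2)// mulr0 addr0 concat_left ?(ltW t2)// => YE.
  by rewrite scale_VFE cst_funE -YE mulrC mulfK// gt_eqF.
Qed.

Lemma concat_velocity_right t : 1 / 2 < t -> t <= 1 ->
  velocity (concat Psi Phi) t = cst_fun (time2' t) *: velocity Psi (time2 t).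
Proof.
move=> t2 t1; have t01 : 0 <= t <= 1 by lra.
have a0 := time2'_gt0 t2; have r2 := smooth_time2.2 _ t01.
have one01 : 0 <= (1 : R) <= 1 by rewrite ler01 lexx.
apply: (@velocity_transport _ _ _ _ _ _ (fun X => cst_fun (time2' t) *: X)) => //.
- exact: smooth_concat.
- exact: concat_surj.
- exact: surjPsi.
- by rewrite scaler0.
- move=> X vX f x; have [d1 u1] := path_unit_derive f x sPhi (smooth_time1.2 _ t01).
  have := concat_unit_derive u1 (vX f (Phi 1 x)).
  rewrite time1'_end ?(ltW t2)// mulr0 add0r concat_right ?(ltW t2)//.
  by rewrite scale_VFE cst_funE mulrC.
- move=> Y vY; exists (cst_fun (time2' t)^-1 *: Y) => f y.
  have [x <-] := surjPhi one01 y.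
  have [d1 u1] := path_unit_derive f x sPhi (smooth_time1.2 _ t01).
  have [d2 u2] := path_unit_derive f (Phi 1 x) sPsi r2.
  have := unit_derive_unique t01 (concat_unit_derive u1 u2) (vY f x).
  rewrite time1'_end ?(ltW t2)// mulr0 add0r concat_right ?(ltW t2)// => YE.
  by rewrite scale_VFE cst_funE -YE mulrC mulfK// gt_eqF.
Qed.

Lemma concat_velocity_half : velocity (concat Psi Phi) (1 / 2) = 0.
Proof.
have t01 : 0 <= (1 / 2 : R) <= 1 by lra.
apply: velocityE => //; first exact: smooth_concat.
  exact: concat_surj.
move=> f x; have [d1 u1] := path_unit_derive f x sPhi (smooth_time1.2 _ t01).
have [d2 u2] := path_unit_derive f (Phi 1 x) sPsi (smooth_time2.2 _ t01).
have := concat_unit_derive u1 u2.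
by rewrite time1'_end// time2'_start// !mulr0 addr0.
Qed.

End Pair.
End Concatenation.

(** * Symplectic and Hamiltonian paths *)

Section SymplecticPaths.
Context {R : realType} {M : closedManifold R} (omega : VF M -> VF M -> Cinf M).
Implicit Types (h k : M -> M) (Psi Phi : R -> M -> M) (X Y : VF M).

Lemma symp_path_smooth Psi : symp_path omega Psi -> smooth_path Psi.
Proof. by case. Qed.

Lemma symp_path_surj Psi : symp_path omega Psi ->
  forall t, 0 <= t <= 1 -> forall y, exists x, Psi t x = y.
Proof.
move=> [_ sPsi _] t /sPsi [[_ [k [_ _ kK]]] _] y.
by exists (k y).
Qed.

Lemma symp_path_concat Psi Phi : symp_path omega Psi -> symp_path omega Phi ->
  symp_path omega (concat Psi Phi).
Proof.
move=> [sPsi oPsi Psi0] [sPhi oPhi Phi0]; split; first exact: smooth_concat.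
  move=> t t01; apply: symplectomorphism_comp.
    exact/oPsi/smooth_time2.2.
  exact/oPhi/smooth_time1.2.
exact: concat0.
Qed.

Lemma symp_path_id : symp_path omega (fun=> id).
Proof.
split=> //; first exact/smooth_path_cst/smooth_map_id.
by move=> *; exact: symplectomorphism_id.
Qed.

Lemma smooth_time_rev : smooth_time (fun t : R => 1 - t).
Proof.
split=> [|t]; last lra.
apply: (@eq_smooth_on _ _ _ _ (fun t : R^o => (1 + (-1) * t : R^o))).
  by move=> t _; rewrite mulN1r.
apply: (smooth_onD (f := cst 1) (g := fun t : R^o => (-1) * t : R^o)).
  exact: smooth_on_cst.
apply: (smooth_onM (f := cst (-1)) (g := id)); first exact: smooth_on_cst.
exact: smooth_on_id.
Qed.

(** Running a path backwards from its end reaches the inverse of the end; unlike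
    the path of inverses, it is smooth without the inverse function theorem. *)
Lemma symp_path_rev Psi k : symp_path omega Psi ->
  cancel (Psi 1) k -> cancel k (Psi 1) ->
  symp_path omega (fun t => Psi (1 - t) \o k).
Proof.
move=> [sPsi oPsi Psi0] hK kK.
have one01 : 0 <= (1 : R) <= 1 by rewrite ler01 lexx.
have ok := symplectomorphism_inv (oPsi 1 one01) hK kK.
have sk : smooth_map k by have [[]] := ok.
split.
- exact: (smooth_path_comp sPsi (smooth_path_cst sk) smooth_time_id smooth_time_rev).
- move=> t t01; apply: symplectomorphism_comp => //.
  exact/oPsi/smooth_time_rev.2.
- by apply/funext => x /=; rewrite subr0 kK.
Qed.

Lemma symp_path_conj Psi h k : symp_path omega Psi -> symplectomorphism omega h ->
  cancel h k -> cancel k h -> symp_path omega (fun t => h \o Psi t \o k).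
Proof.
move=> [sPsi oPsi Psi0] oh hK kK.
have ok := symplectomorphism_inv oh hK kK.
have sk : smooth_map k by have [[]] := ok.
have sh : smooth_map h by have [[]] := oh.
split.
- have := smooth_path_comp (smooth_path_cst sh) sPsi smooth_time_id smooth_time_id.
  move=> /smooth_path_comp/(_ (smooth_path_cst sk)).
  by move=> /(_ _ _ smooth_time_id smooth_time_id).
- move=> t t01; apply: symplectomorphism_comp => //.
  by apply: symplectomorphism_comp => //; exact: oPsi.
- by apply/funext => x /=; rewrite Psi0 kK.
Qed.

Lemma Symp0_symplectomorphism h : Symp0 omega h -> symplectomorphism omega h.
Proof. by move=> [Psi [_ oPsi _] <-]; apply: oPsi; rewrite ler01 lexx. Qed.

Lemma Symp0_inv_mapK h : Symp0 omega h ->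
  cancel h (inv_map h) /\ cancel (inv_map h) h.
Proof. by move=> /Symp0_symplectomorphism[dh _]; exact: inv_mapK. Qed.

Lemma Symp0_comp h k : Symp0 omega h -> Symp0 omega k -> Symp0 omega (h \o k).
Proof.
move=> [Psi sPsi <-] [Phi sPhi <-]; exists (concat Psi Phi).
  exact: symp_path_concat.
by rewrite concat1.
Qed.

Lemma Symp0_inv h : Symp0 omega h -> Symp0 omega (inv_map h).
Proof.
move=> Sh; have [hK kK] := Symp0_inv_mapK Sh.
have [Psi sPsi PsiE] := Sh; rewrite -PsiE in hK kK.
exists (fun t => Psi (1 - t) \o inv_map h); rewrite -{1}PsiE; first exact: symp_path_rev.
by case: sPsi => _ _ Psi0; rewrite subrr Psi0 PsiE.
Qed.

Lemma Ham_Symp0 : Ham omega `<=` Symp0 omega.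
Proof. by move=> _ [Psi [sPsi _] <-]; exists Psi. Qed.

Hypothesis omega_symp : symplectic_form omega.

Lemma omega0 : omega 0 = 0.
Proof.
have [lo _ _ _] := omega_symp; apply/funext => Y.
have := lo Y (-1) 0 0; rewrite scaler0 addr0 mulN1r addNr.
by move=> ->.
Qed.

Lemma omegaZ (f : Cinf M) X Y : omega (f *: X) Y = f * omega X Y.
Proof.
have [lo _ _ _] := omega_symp.
by have := lo Y f X 0; rewrite addr0 omega0 => ->; rewrite addr0.
Qed.

Lemma omega_cst_scale a X : omega (cst_fun a *: X) = a *: omega X.
Proof.
apply/funext => Y; rewrite omegaZ; apply: Cinf_ext => x.
by rewrite -[LHS]/(cst_fun a x * omega X Y x) cst_funE.
Qed.

(** If omega X = df then omega (h_* X) (Y) is, at h x, the value of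
    omega X (h^* Y) = df (h^* Y) at x: it is d (f o h^-1). *)
Lemma symplectic_exact_pushforward h k (sh : smooth_map h) (sk : smooth_map k)
    (hK : cancel h k) (kK : cancel k h) X :
  symplectomorphism omega h -> omega X \in exact_form ->
  omega (pushforward sh sk kK X) \in exact_form.
Proof.
move=> [_ oh] /asboolP[f Xf]; apply/asboolP; exists (pullback sk f) => Y.
apply: Cinf_ext => y; rewrite -(kK y).
have kY := pushforward_related sk sh hK Y kK.
rewrite -(oh _ _ _ _ (pushforward_related sh sk kK X hK)
  (related_inv sh hK kK kY)).
by rewrite Xf (kY f (pullback sk f))// hK.
Qed.

Lemma Ham_id : Ham omega id.
Proof.
exists (fun=> id) => //; split=> [|t t01]; first exact: symp_path_id.
rewrite /alpha_path (@velocityE _ _ _ _ 0) ?omega0 ?rpred0//.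
- exact/smooth_path_cst/smooth_map_id.
- by move=> y; exists y.
- by move=> f x; exact: unit_derive_cst.
Qed.

(** At time 1/2 the concatenation is at rest, and elsewhere its form is a
    multiple of an exact one. *)
Lemma Ham_comp h k : Ham omega h -> Ham omega k -> Ham omega (h \o k).
Proof.
move=> [Psi [sPsi ePsi] <-] [Phi [sPhi ePhi] <-]; exists (concat Psi Phi); last first.
  by rewrite concat1.
split=> [|t /andP[t0 t1]]; first exact: symp_path_concat.
have [ssPsi _ Psi0] := sPsi; have [ssPhi _ Phi0] := sPhi.
have jPsi := symp_path_surj sPsi; have jPhi := symp_path_surj sPhi.
rewrite /alpha_path; have [t2|t2|->] := ltgtP t (1 / 2).
- rewrite concat_velocity_left// omega_cst_scale rpredZ//; apply: ePhi.
  by apply: smooth_time1.2; rewrite t0.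
- rewrite concat_velocity_right// omega_cst_scale rpredZ//; apply: ePsi.
  by apply: smooth_time2.2; rewrite t0.
- by rewrite concat_velocity_half// omega0 rpred0.
Qed.

(** The velocity of h Psi_t h^-1 is the pushforward by h of that of Psi. *)
Lemma Ham_conj h k : Symp0 omega h -> Ham omega k ->
  Ham omega (h \o k \o inv_map h).
Proof.
move=> Sh [Psi [sPsi ePsi] <-]; have [hK iK] := Symp0_inv_mapK Sh.
have oh := Symp0_symplectomorphism Sh.
have oi := Symp0_symplectomorphism (Symp0_inv Sh).
have sh : smooth_map h by have [[]] := oh.
have si : smooth_map (inv_map h) by have [[]] := oi.
have sC := symp_path_conj sPsi oh hK iK.
exists (fun t => h \o Psi t \o inv_map h) => //; split=> // t t01; rewrite /alpha_path.
have -> : velocity (fun t => h \o Psi t \o inv_map h) t =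
    pushforward sh si iK (velocity Psi t).
  apply: velocity_transport => //.
  - exact: symp_path_smooth sC.
  - exact: symp_path_smooth sPsi.
  - exact: symp_path_surj sC t t01.
  - exact: symp_path_surj sPsi t t01.
  - exact: VF_ext.
  - move=> X vX f x; have := vX (pullback sh f) (inv_map h x).
    by rewrite -[pushforward _ _ _ _ _ _]/(X (pullback sh f)
      (inv_map h (h (Psi t (inv_map h x))))) hK.
  - move=> Y vY; exists (pushforward si sh hK Y) => f x.
    have := vY (pullback si f) (h x); rewrite /= hK.
    by apply: unit_derive_ext => s _ /=; rewrite !hK.
apply: symplectic_exact_pushforward => //; exact: ePsi.
Qed.

End SymplecticPaths.

(** * Lower integrals *)

Section LowerIntegral.
Local Open Scope ereal_scope.
Context d (T : measurableType d) (R : realType) (mu : {measure set T -> \bar R}).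
Implicit Types (D : set T) (f : T -> \bar R).
Import HBNNSimple.

(** The integral of a nonnegative function is by definition a supremum over the
    simple functions below it. The lemmas of this part hold without
    measurability of the integrand because they are read off that supremum. *)

Lemma le_lower_integral D f1 f2 : (forall x, D x -> 0 <= f1 x) ->
  (forall x, D x -> f1 x <= f2 x) ->
  \int[mu]_(x in D) f1 x <= \int[mu]_(x in D) f2 x.
Proof.
move=> f10 f12; have f20 x : D x -> 0 <= f2 x.
  by move=> Dx; exact: le_trans (f10 x Dx) (f12 x Dx).
rewrite !ge0_integralE//; apply: ereal_sup_le => _ [h /= hf1 <-].
exists h => //= x; apply: le_trans (hf1 x) _.
by rewrite /patch; case: ifPn => // /set_mem; exact: f12.
Qed.

Lemma le_lower_integral_domain D1 D2 f : D1 `<=` D2 -> (forall x, D2 x -> 0 <= f x) ->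
  \int[mu]_(x in D1) f x <= \int[mu]_(x in D2) f x.
Proof.
move=> D12 f0; rewrite (integral_mkcond D1) (integral_mkcond D2).
apply: le_lower_integral => x _; rewrite /patch.
  by case: ifPn => // /set_mem/D12/f0.
case: ifPn => [/set_mem xD|_]; first by rewrite mem_set//; exact: D12.
by case: ifPn => // /set_mem/f0.
Qed.

(** Measurable minorants replace simple ones, which lets a minorant be
    transformed by a substitution. *)
Lemma lower_integral_ub D f (b : \bar R) : measurable D ->
  (forall x, D x -> 0 <= f x) ->
  (forall h : T -> R, measurable_fun setT h -> (forall x, (0 <= h x)%R) ->
    (forall x, D x -> (h x)%:E <= f x) -> \int[mu]_(x in D) (h x)%:E <= b) ->
  \int[mu]_(x in D) f x <= b.
Proof.
move=> mD f0 H; rewrite ge0_integralE//; apply: ge_ereal_sup => _ [h /= hf <-].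
have hD x : ~ D x -> h x = 0%R.
  move=> Dx; apply/eqP; rewrite eq_le fun_ge0 andbT -lee_fin.
  by have := hf x; rewrite patchN// notin_setE.
rewrite -integralT_nnsfun.
suff -> : \int[mu]_x (h x)%:E = \int[mu]_(x in D) (h x)%:E.
  apply: H => // x Dx; have := hf x.
  by rewrite patchT// inE.
rewrite [RHS]integral_mkcond; apply: eq_integral => x _; rewrite /patch.
by case: ifPn => // /negP xD; rewrite hD// => Dx; apply: xD; rewrite inE.
Qed.

Lemma lower_integralZl D f (k : R) : (0 < k)%R -> (forall x, D x -> 0 <= f x) ->
  \int[mu]_(x in D) (k%:E * f x) = k%:E * \int[mu]_(x in D) f x.
Proof.
move=> k0 f0.
have le (k' : R) f' : (0 < k')%R -> (forall x, D x -> 0 <= f' x) ->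
    k'%:E * \int[mu]_(x in D) f' x <= \int[mu]_(x in D) (k'%:E * f' x).
  move=> {}k0 {}f0; rewrite -lee_pdivlMl// ge0_integralE//.
  apply: ge_ereal_sup => _ [h /= hf <-]; rewrite lee_pdivlMl//.
  rewrite ge0_integralE; last by move=> x Dx; apply: mule_ge0; [rewrite lee_fin ltW|exact: f0].
  apply: ereal_sup_ubound; exists (scale_nnsfun h (ltW k0)); last first.
    by rewrite -sintegralrM.
  move=> x; rewrite /= EFinM; have := hf x; rewrite /patch; case: ifPn => _ hx.
    by apply: lee_wpmul2l => //; rewrite lee_fin ltW.
  by apply: mule_ge0_le0 => //; rewrite lee_fin ltW.
apply/eqP; rewrite eq_le le// andbT.
have kf0 x : D x -> 0 <= k%:E * f x by move=> Dx; apply: mule_ge0; [rewrite lee_fin ltW|exact: f0].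
have ki0 : (0 < k^-1)%R by rewrite invr_gt0.
have := le _ _ ki0 kf0; rewrite lee_pdivrMl//.
move=> /le_trans; apply; apply: lee_wpmul2l; first by rewrite lee_fin ltW.
rewrite le_eqVlt; apply/orP; left; apply/eqP; apply: eq_integral => x _.
by rewrite muleA -EFinM mulVf ?mul1e// gt_eqF.
Qed.

(** The lower integral is superadditive in general. Over disjoint measurable
    sets it is additive, since minorants on the two sets can be glued. *)
Lemma lower_integral_setU D1 D2 f : measurable D1 -> measurable D2 ->
  [disjoint D1 & D2] -> (forall x, 0 <= f x) ->
  \int[mu]_(x in D1 `|` D2) f x =
  \int[mu]_(x in D1) f x + \int[mu]_(x in D2) f x.
Proof.
move=> m1 m2 D12 f0; apply/eqP; rewrite eq_le; apply/andP; split.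
  apply: lower_integral_ub => //; first exact: measurableU.
  move=> h mh h0 hf; rewrite ge0_integral_setU//; last 2 first.
  - exact/measurable_EFinP/measurable_funTS.
  - by move=> x _; rewrite lee_fin.
  apply: leeD; apply: le_lower_integral => x Dx; rewrite ?lee_fin//; apply: hf.
    by left.
  by right.
set b := \int[mu]_(x in D1 `|` D2) f x.
have [->|bfin] := eqVneq b +oo; first exact: leey.
have b0 : 0 <= b by exact: integral_ge0.
have fb : b \is a fin_num by rewrite ge0_fin_numE// ltey.
have fin D : D `<=` D1 `|` D2 -> \int[mu]_(x in D) f x \is a fin_num.
  move=> DU; rewrite ge0_fin_numE ?integral_ge0//.
  by apply: le_lt_trans (le_lower_integral_domain DU _) _ => //; rewrite ltey.
have fin1 := fin _ (@subsetUl _ D1 D2); have fin2 := fin _ (@subsetUr _ D1 D2).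
have finh D (h : T -> R) : D `<=` D1 `|` D2 -> (forall x, (0 <= h x)%R) ->
    (forall x, D x -> (h x)%:E <= f x) -> \int[mu]_(x in D) (h x)%:E \is a fin_num.
  move=> DU h0 hf; rewrite ge0_fin_numE; last by apply: integral_ge0 => x _; rewrite lee_fin.
  apply: le_lt_trans (le_lower_integral _ hf) _; first by move=> x _; rewrite lee_fin.
  by rewrite -ge0_fin_numE ?integral_ge0// fin.
rewrite -leeBrDr//; apply: lower_integral_ub => // h1 mh1 h10 h1f.
have f1 := finh D1 h1 (@subsetUl _ D1 D2) h10 h1f.
rewrite leeBrDr// addeC -leeBrDr//; apply: lower_integral_ub => // h2 mh2 h20 h2f.
rewrite leeBrDr// addeC.
pose h x := (h1 x * \1_D1 x + h2 x * \1_D2 x)%R.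
have D1n x : D1 x -> x \notin D2.
  move=> x1; apply/negP => /set_mem x2; move/disj_setPS: D12 => /(_ x); exact.
have h1E x : D1 x -> h x = h1 x.
  move=> x1; rewrite /h !indicE (mem_set x1) (negbTE (D1n x x1)).
  by rewrite mulr1 mulr0 addr0.
have h2E x : D2 x -> h x = h2 x.
  move=> x2; rewrite /h !indicE (mem_set x2) (_ : x \in D1 = false) ?mulr0 ?add0r ?mulr1//.
  by apply/negP => /set_mem/D1n; rewrite (mem_set x2).
have mh : measurable_fun setT h.
  by apply: measurable_funD; apply: measurable_funM => //; exact: measurable_indic.
have h0 x : (0 <= h x)%R by rewrite addr_ge0// mulr_ge0.
rewrite (_ : \int[mu]_(x in D1) (h1 x)%:E = \int[mu]_(x in D1) (h x)%:E); last first.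
  by apply: eq_integral => x /set_mem x1; rewrite h1E.
rewrite (_ : \int[mu]_(x in D2) (h2 x)%:E = \int[mu]_(x in D2) (h x)%:E); last first.
  by apply: eq_integral => x /set_mem x1; rewrite h2E.
rewrite -ge0_integral_setU//; last 2 first.
- exact/measurable_EFinP/measurable_funTS.
- by move=> x _; rewrite lee_fin.
apply: le_lower_integral => x; first by rewrite lee_fin.
by move=> [x1|x2]; [rewrite h1E// h1f|rewrite h2E// h2f].
Qed.

Lemma lower_integral_null D f : measurable D -> mu D = 0 -> (forall x, D x -> 0 <= f x) ->
  \int[mu]_(x in D) f x = 0.
Proof.
move=> mD D0 f0; apply/eqP; rewrite eq_le integral_ge0// andbT.
apply: lower_integral_ub => // h mh h0 hf; rewrite null_set_integral//.
exact/measurable_EFinP/measurable_funTS.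
Qed.

End LowerIntegral.

(** * Change of variables in lower integrals *)

(** Rays generate the Borel sets and are stable under intersection. *)
Lemma measure_eq_rays (R : realType) (m1 m2 : {measure set (measurableTypeR R) -> \bar R}) :
  (forall y, m1 `]-oo, y[%classic = m2 `]-oo, y[%classic) ->
  (forall y, m1 `]-oo, y[%classic < +oo)%E ->
  forall A, measurable A -> m1 A = m2 A.
Proof.
move=> m12 m1oo A; pose g n : set (measurableTypeR R) := `]-oo, n%:R[%classic.
apply: (@measure_unique _ R (measurableTypeR R) _ g (RGenInftyO.measurableE R)).
- move=> _ _ [x ->] [y ->]; exists (Num.min x y).
  apply/seteqP; split=> z /=; rewrite !in_itv/= lt_min; first by move=> [-> ->].
  by move=> /andP.
- by move=> n; exists n%:R.
- apply/seteqP; split=> // x _; exists (Num.truncn `|x|).+1 => //.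
  by rewrite /g /= in_itv/= (le_lt_trans (ler_norm x))// truncnS_gt.
- by move=> _ [y ->].
- by move=> n; exact: m1oo.
Qed.

Section ChangeOfVariables.
Context {R : realType}.
Variables (sigma s kappa : R -> R) (a b : R).
Hypothesis ab : a < b.
Hypothesis dsigma : forall x : R, is_derive x 1 sigma (s x).
Hypothesis cs : continuous s.
Hypothesis s_ge0 : forall x, 0 <= s x.
Hypothesis s_gt0 : forall x, a < x < b -> 0 < s x.
Hypothesis kappa_itv : forall y, sigma a < y < sigma b -> a < kappa y < b.
Hypothesis kappaK : forall y, sigma a < y < sigma b -> sigma (kappa y) = y.
Hypothesis sigmaK : forall x, a < x < b -> kappa (sigma x) = x.
Hypothesis ckappa : forall y, sigma a < y < sigma b -> {for y, continuous kappa}.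

Notation mu := (@lebesgue_measure R).
Notation c := (sigma a).
Notation d := (sigma b).
Import HBNNSimple.

Let csigma : continuous sigma.
Proof.
by move=> x; apply/differentiable_continuous/derivable1_diffP; case: (dsigma x).
Qed.

Let msigma : measurable_fun setT sigma.
Proof. exact: continuous_measurable_fun. Qed.

Let ms : measurable_fun setT s.
Proof. exact: continuous_measurable_fun. Qed.

Let sigma_lt : {in `[a, b] &, {homo sigma : x y / x < y}}.
Proof.
apply: gtr0_derive1_lt_cc; last exact: continuous_subspaceT.
  by move=> x _; case: (dsigma x).
by move=> x; rewrite in_itv/= => xab; rewrite derive1E; case: (dsigma x) => _ ->; exact: s_gt0.
Qed.

Let ain : a \in `[a, b]. Proof. by rewrite in_itv/= lexx ltW. Qed.
Let bin : b \in `[a, b]. Proof. by rewrite in_itv/= lexx ltW. Qed.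
Let oo_in x : a < x < b -> x \in `[a, b].
Proof. by move=> /andP[ax xb]; rewrite in_itv/= !ltW. Qed.

Let sigma_itv x : a < x < b -> c < sigma x < d.
Proof. by move=> xab; have /andP[ax xb] := xab; rewrite !sigma_lt// oo_in. Qed.

Let cd : c < d. Proof. exact: sigma_lt. Qed.

Let ms_itv D : measurable_fun D (EFin \o s).
Proof. exact/measurable_EFinP/measurable_funTS. Qed.

Let int_s u : a < u -> (\int[mu]_(x in `]a, u[) (s x)%:E = (sigma u - c)%:E)%E.
Proof.
move=> au; rewrite -(@integral_itv_bndoo R a u (EFin \o s) true false); last exact: ms_itv.
rewrite (@continuous_FTC2 _ s sigma)//.
- exact: continuous_subspaceT.
- split; first by move=> x _; case: (dsigma x).
    by apply: cvg_at_right_filter; exact: csigma.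
  by apply: cvg_at_left_filter; exact: csigma.
- by move=> x _; rewrite derive1E; case: (dsigma x).
Qed.

(** The image under sigma of the measure with density s on ]a, b[. *)
Definition density_image (A : set (measurableTypeR R)) : \bar R :=
  (\int[mu]_(x in `]a, b[ `&` sigma @^-1` A) (s x)%:E)%E.

Local Notation m := density_image.

Let mpre (A : set (measurableTypeR R)) : measurable A ->
  measurable (`]a, b[ `&` sigma @^-1` A : set (measurableTypeR R)).
Proof.
by move=> mA; apply: measurableI => //; rewrite -[X in measurable X]setTI; exact: msigma.
Qed.

Let m0 : m set0 = 0%E.
Proof. by rewrite /m preimage_set0 setI0 integral_set0. Qed.

Let m_ge0 A : (0 <= m A)%E.
Proof. by apply: integral_ge0 => x _; rewrite lee_fin. Qed.

Let m_sigma_additive : semi_sigma_additive m.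
Proof.
move=> F mF tF mUF; rewrite /m preimage_bigcup setI_bigcupr ge0_integral_bigcup//.
- apply: is_cvg_ereal_nneg_natsum_cond => n _ _; exact: m_ge0.
- by move=> k; exact: mpre.
- exact: ms_itv.
- by move=> x _; rewrite lee_fin.
- apply/trivIsetP => i j _ _ ij; rewrite setIACA setIid -preimage_setI.
  by move/trivIsetP : tF => ->//; rewrite preimage_set0 setI0.
Qed.

HB.instance Definition _ := isMeasure.Build _ (measurableTypeR R) R m m0 m_ge0 m_sigma_additive.

(** By the fundamental theorem of calculus. *)
Let m_ray y : m `]-oo, y[ = mu (`]-oo, y[ `&` `]c, d[).
Proof.
rewrite /m; have [yc|cy] := leP y c.
  rewrite (_ : _ `&` _ = set0) ?integral_set0; last first.
    apply/seteqP; split=> // x [/=]; rewrite !in_itv/= => /sigma_itv/andP[cx _] xy.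
    by have := lt_trans (lt_le_trans xy yc) cx; rewrite ltxx.
  rewrite (_ : _ `&` _ = set0) ?measure0//.
  apply/seteqP; split=> // x [/=]; rewrite !in_itv/= => xy /andP[cx _].
  by have := lt_trans (lt_le_trans xy yc) cx; rewrite ltxx.
have [dy|yd] := leP d y.
  rewrite (_ : _ `&` _ = `]a, b[%classic); last first.
    apply/seteqP; split=> [x []//|x /[dup] + xab]; rewrite /= in_itv/= => xab'.
    by split=> //=; rewrite in_itv/=; have /andP[_ /lt_le_trans] := sigma_itv xab'; apply.
  rewrite int_s// (_ : _ `&` _ = `]c, d[%classic); last first.
    apply/seteqP; split=> [x []//|x /[dup] + xcd]; rewrite /= in_itv/= => /andP[_ xd].
    by split=> //=; rewrite in_itv/= (lt_le_trans xd).
  by rewrite lebesgue_measure_itv/= lte_fin cd.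
have ycd : c < y < d by rewrite cy.
have /andP[ak kb] := kappa_itv ycd.
rewrite (_ : _ `&` _ = `]a, kappa y[%classic); last first.
  apply/seteqP; split=> x /=; rewrite !in_itv/=.
    move=> [xab xy]; have /andP[-> _] := xab; rewrite ltNge; apply/negP => kx.
    have : sigma (kappa y) <= sigma x.
      move: kx; rewrite le_eqVlt => /predU1P[->//|kx]; apply/ltW/sigma_lt => //.
        by apply: oo_in; rewrite ak.
      exact: oo_in.
    by rewrite kappaK// leNgt xy.
  move=> /andP[ax xk]; have xab : a < x < b by rewrite ax (lt_trans xk).
  split=> //; rewrite -[ltRHS](kappaK ycd); apply: sigma_lt => //.
    exact: oo_in.
  by apply: oo_in; rewrite ak.
rewrite int_s// kappaK// (_ : _ `&` _ = `]c, y[%classic); last first.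
  apply/seteqP; split=> x /=; rewrite !in_itv/=; first by move=> [-> /andP[->]].
  by move=> /andP[-> xy]; rewrite xy (lt_trans xy).
by rewrite lebesgue_measure_itv/= lte_fin cy.
Qed.

(** The image measure is the Lebesgue measure on ]c, d[. *)
Let mE A : measurable A -> m A = mu (A `&` `]c, d[).
Proof.
have mcd : measurable (`]c, d[ : set (measurableTypeR R)) by [].
move: A; apply: (@measure_eq_rays R m (mrestr mu mcd)); first exact: m_ray.
move=> y; rewrite /= m_ray (@le_lt_trans _ _ (mu `]c, d[%classic))//.
  by apply: le_measure; rewrite ?inE//; apply: measurableI.
by rewrite lebesgue_measure_itv/= lte_fin cd ltry.
Qed.

Local Open Scope ereal_scope.

Let subst_nnsfun (k : {nnsfun (measurableTypeR R) >-> R}) :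
  \int[mu]_(x in `]a, b[) (s x * k (sigma x))%:E = \int[mu]_(y in `]c, d[) (k y)%:E.
Proof.
have mk r : measurable (k @^-1` [set r]) by [].
have ind0 r x : (0 <= (\1_(k @^-1` [set r]) x : R))%R by rewrite indicE.
have mind r : measurable_fun setT ((\1_(k @^-1` [set r]) : R -> R) \o sigma).
  exact: (measurableT_comp (measurable_indic (mk r)) msigma).
transitivity (\sum_(r \in range k)
    \int[mu]_(x in `]a, b[) (r%:E * (s x * \1_(k @^-1` [set r]) (sigma x))%:E)).
  rewrite -ge0_integral_fsum//.
  - apply: eq_integral => x _; rewrite {1}(fimfunE k (sigma x)) !fsbig_finite//=.
    rewrite mulr_sumr -sumEFin; apply: eq_bigr => r _.
    by rewrite -EFinM mulrCA.
  - move=> r; apply/measurable_EFinP/measurable_funTS.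
    exact: (measurable_funM (measurable_cst r) (measurable_funM ms (mind r))).
  - move=> r x _; have [r0|r0] := leP 0%R r.
      by rewrite -EFinM lee_fin !mulr_ge0.
    by rewrite preimage_nnfun0// indic0 mulr0 mule0.
transitivity (\sum_(r \in range k) \int[mu]_(y in `]c, d[) (r%:E * (\1_(k @^-1` [set r]) y)%:E)).
  apply: eq_fsbigr => r /set_mem [y _ <-].
  have mky := mk (k y); have k0 : (0 <= k y)%R by [].
  rewrite ge0_integralZl_EFin//; last 2 first.
  - by move=> x _; rewrite lee_fin mulr_ge0.
  - apply/measurable_EFinP/measurable_funTS.
    exact: (measurable_funM ms (mind (k y))).
  rewrite [RHS]ge0_integralZl_EFin//; last first.
    exact/measurable_EFinP/measurable_indic.
  congr (_ * _); transitivity (density_image (k @^-1` [set k y])); last first.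
    by rewrite integral_indic//; exact: mE.
  rewrite /density_image integral_mkcondr; apply: eq_integral => x _.
  rewrite /patch indicE; case: ifPn => [/set_mem xk|xk].
    by rewrite mem_set ?mulr1.
  by rewrite memNset ?mulr0// => H; move/negP: xk; apply; exact: mem_set.
rewrite -ge0_integral_fsum//.
- apply: eq_integral => y _; rewrite [in RHS](fimfunE k y) -fsumEFin//.
- move=> r; apply/measurable_EFinP/measurable_funTS.
  exact: (measurable_funM (measurable_cst r) (measurable_indic (mk r))).
- move=> r y _; have [r0|r0] := leP 0%R r.
    by rewrite -EFinM lee_fin mulr_ge0.
  by rewrite preimage_nnfun0// indic0 mule0.
Qed.

Let subst_mfun (k : R -> R) : measurable_fun `]c, d[ k ->
  (forall y, `]c, d[%classic y -> (0 <= k y)%R) ->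
  \int[mu]_(x in `]a, b[) (s x * k (sigma x))%:E = \int[mu]_(y in `]c, d[) (k y)%:E.
Proof.
move=> mk k0.
have mcd : measurable (`]c, d[ : set (measurableTypeR R)) by [].
have mf : measurable_fun (`]c, d[ : set (measurableTypeR R)) (EFin \o k).
  exact/measurable_EFinP.
have f0 y : `]c, d[%classic y -> 0 <= (EFin \o k) y by move=> /k0; rewrite /= lee_fin.
pose h := nnsfun_approx mcd mf.
have -> : \int[mu]_(y in `]c, d[) (k y)%:E =
    limn (fun n => \int[mu]_(y in `]c, d[) (EFin \o h n) y).
  rewrite -monotone_convergence//.
  - by apply: eq_integral => y /set_mem ycd; apply/esym/cvg_lim => //;
      exact: (cvg_nnsfun_approx mcd mf f0 ycd).
  - move=> n; exact/measurable_EFinP/measurable_funTS/measurable_funP.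
  - by move=> n y _; rewrite lee_fin.
  - by move=> y _ n n' nn'; rewrite lee_fin; exact/lefP/nd_nnsfun_approx.
have -> : (fun n => \int[mu]_(y in `]c, d[) (EFin \o h n) y) =
    (fun n => \int[mu]_(x in `]a, b[) (s x * h n (sigma x))%:E).
  by apply/funext => n; exact/esym/(subst_nnsfun (h n)).
rewrite -monotone_convergence//.
- apply: eq_integral => x /set_mem xab; apply/esym/cvg_lim => //.
  under eq_fun do rewrite EFinM.
  rewrite EFinM; apply: cvgeZl => //.
  by apply: (cvg_nnsfun_approx mcd mf f0); move: xab; rewrite /= !in_itv/=; exact: sigma_itv.
- move=> n; apply/measurable_EFinP/measurable_funTS.
  exact: (measurable_funM ms (measurableT_comp (measurable_funP (h n)) msigma)).
- by move=> n x _; rewrite lee_fin mulr_ge0.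
- move=> x _ n n' nn'; rewrite lee_fin ler_wpM2l//.
  by have /lefP/(_ (sigma x)) := nd_nnsfun_approx mcd mf nn'.
Qed.

(** Change of variables for a function that need not be measurable: the
    substitution and its inverse exchange the measurable functions below F
    on one side and those below s * (F \o sigma) on the other. *)
Lemma lower_integral_subst (F : R -> R) : (forall y, (0 <= F y)%R) ->
  \int[mu]_(x in `]a, b[) (s x * F (sigma x))%:E = \int[mu]_(y in `]c, d[) (F y)%:E.
Proof.
move=> F0; apply/eqP; rewrite eq_le; apply/andP; split; last first.
  apply: lower_integral_ub => // [y _|h mh h0 hF]; first by rewrite lee_fin.
  rewrite -subst_mfun//; last exact: measurable_funTS.
  apply: le_lower_integral => x; rewrite /= in_itv/= => xab; rewrite lee_fin ?mulr_ge0//.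
  by rewrite ler_wpM2l// -lee_fin hF//= in_itv/= sigma_itv.
apply: lower_integral_ub => // [x _|h mh h0 hF]; first by rewrite lee_fin mulr_ge0.
pose k y : R := (h (kappa y) * (s (kappa y))^-1)%R.
have k0 y : (0 <= k y)%R by rewrite mulr_ge0// invr_ge0.
have mk : measurable_fun `]c, d[ k.
  have mkappa : measurable_fun (`]c, d[%classic : set R) kappa.
    apply: open_continuous_measurable_fun => // y /set_mem; rewrite /= in_itv/= => ycd.
    exact: ckappa.
  apply: measurable_funM; first exact: measurableT_comp.
  apply: open_continuous_measurable_fun => // y /set_mem; rewrite /= in_itv/= => ycd.
  apply: cvgV; first by rewrite gt_eqF// s_gt0// kappa_itv.
  by apply: (@continuous_comp _ _ _ kappa s); [exact: ckappa|exact: cs].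
have -> : \int[mu]_(x in `]a, b[) (h x)%:E = \int[mu]_(x in `]a, b[) (s x * k (sigma x))%:E.
  apply: eq_integral => x /set_mem; rewrite /= in_itv/= => xab.
  by rewrite /k sigmaK// mulrCA mulfV ?mulr1// gt_eqF// s_gt0.
rewrite subst_mfun//; apply: le_lower_integral => y; rewrite /= in_itv/= => ycd.
  by rewrite lee_fin.
have kab := kappa_itv ycd; rewrite lee_fin ler_pdivrMr ?s_gt0//.
have := hF (kappa y); rewrite kappaK// lee_fin mulrC; apply.
by rewrite /= in_itv.
Qed.

End ChangeOfVariables.

(** * Reparametrised speeds *)

Section Reparametrisation.
Context {R : realType}.
Notation mu := (@lebesgue_measure R).

Lemma continuous_flat_inv (y : R) : 0 < y < 1 -> {for y, continuous flat_inv}.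
Proof.
move=> y01; have /andP[y0 _] := y01; have l0 := ln_lt0 y01.
apply: (@cvgV _ _ _ _ (fun y : R => 1 - ln y)); first by rewrite gt_eqF// subr_gt0 (lt_trans l0).
by apply: cvgB; [exact: cvg_cst|exact: continuous_ln].
Qed.

Lemma continuous_affine (g : R -> R) (a b : R) : continuous g ->
  continuous (fun t => 2 * g (a * t + b)).
Proof.
move=> cg t; apply: cvgM; first exact: cvg_cst.
apply: (@continuous_comp _ _ _ (fun t => a * t + b) g); last exact: cg.
by apply: cvgD; [apply: cvgM; [exact: cvg_cst|exact: cvg_id]|exact: cvg_cst].
Qed.

Lemma time1'_ge0 (t : R) : 0 <= time1' t.
Proof. by rewrite mulr_ge0// flat'_ge0. Qed.

Lemma time2'_ge0 (t : R) : 0 <= time2' t.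
Proof. by rewrite mulr_ge0// flat'_ge0. Qed.

Lemma lower_integral_time2 (F : R -> R) : (forall y, 0 <= F y) ->
  (\int[mu]_(t in `](1 / 2)%R, 1%R[) (time2' t * F (time2 t))%:E =
   \int[mu]_(t in `]0%R, 1%R[) (F t)%:E)%E.
Proof.
move=> F0; have t2 : time2 (1 / 2 : R) = 0 by rewrite time2_start.
pose kappa (y : R) := (flat_inv y + 1) / 2.
transitivity (\int[mu]_(t in `]time2 (1 / 2)%R, time2 1%R[) (F t)%:E)%E; last first.
  by rewrite t2 time2_1.
apply: (@lower_integral_subst _ time2 time2' kappa) => //.
- lra.
- exact: is_derive_time2.
- exact: (@continuous_affine flat' 2 (-1) (@continuous_flat' R)).
- exact: time2'_ge0.
- by move=> x /andP[x2 _]; exact: time2'_gt0.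
- rewrite t2 time2_1 => y /flat_inv_itv; rewrite /kappa; lra.
- rewrite t2 time2_1 => y y01; rewrite /time2 /kappa.
  by rewrite (_ : 2 * _ - 1 = flat_inv y) ?flat_invK//; field.
- move=> x /andP[x2 _]; rewrite /kappa /time2 flatK; last lra.
  by field.
- rewrite t2 time2_1 => y y01; apply: cvgM; last exact: cvg_cst.
  by apply: cvgD; [exact: continuous_flat_inv|exact: cvg_cst].
Qed.

Lemma lower_integral_time1 (F : R -> R) : (forall y, 0 <= F y) ->
  (\int[mu]_(t in `]0%R, (1 / 2)%R[) (time1' t * F (time1 t))%:E =
   \int[mu]_(t in `]0%R, 1%R[) (F t)%:E)%E.
Proof.
move=> F0; have t1 : time1 (1 / 2 : R) = 1 by rewrite time1_end.
pose kappa (y : R) := (1 - flat_inv (1 - y)) / 2.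
have itv (y : R) : 0 < y < 1 -> 0 < 1 - y < 1 by lra.
transitivity (\int[mu]_(t in `]time1 0%R, time1 (1 / 2)%R[) (F t)%:E)%E; last first.
  by rewrite t1 time1_0.
apply: (@lower_integral_subst _ time1 time1' kappa) => //.
- exact: is_derive_time1.
- move=> t; rewrite (_ : time1' = fun t => 2 * flat' ((-2) * t + 1)); last first.
    by apply/funext => u; rewrite /time1' mulNr [- _ + _]addrC.
  exact: (@continuous_affine flat' (-2) 1 (@continuous_flat' R)).
- exact: time1'_ge0.
- by move=> x /andP[_ x2]; exact: time1'_gt0.
- rewrite t1 time1_0 => y /itv/flat_inv_itv; rewrite /kappa; lra.
- rewrite t1 time1_0 => y /itv y01; rewrite /time1 /kappa.
  rewrite (_ : 1 - 2 * _ = flat_inv (1 - y)); last by field.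
  by rewrite flat_invK// subKr.
- move=> x /andP[_ x2]; rewrite /kappa /time1 subKr flatK; last lra.
  by field.
- rewrite t1 time1_0 => y /itv y01; apply: cvgM; last exact: cvg_cst.
  apply: cvgB; first exact: cvg_cst.
  apply: (@cvg_comp _ _ _ (fun y => 1 - y) flat_inv _ (nbhs (1 - y))).
    by apply: cvgB; [exact: cvg_cst|exact: cvg_id].
  exact: continuous_flat_inv.
Qed.

Lemma lower_integral_open (F : R -> R) : (forall y, 0 <= F y) ->
  (\int[mu]_(t in `[0%R, 1%R]) (F t)%:E = \int[mu]_(t in `]0%R, 1%R[) (F t)%:E)%E.
Proof.
move=> F0; have mp (x : R) : measurable ([set x] : set (measurableTypeR R)) by [].
have -> : `[0%R, 1%R]%classic = `]0%R, 1%R[%classic `|` ([set 0] `|` [set 1]) :> set R.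
  apply/seteqP; split=> x /=; rewrite !in_itv/=.
    move=> /andP[]; rewrite le_eqVlt => /predU1P[<- _|x0]; first by right; left.
    by rewrite le_eqVlt => /predU1P[->|x1]; [right; right|left; rewrite x0].
  by move=> [/andP[x0 x1]|[->|->]]; rewrite ?lexx ?ler01// !ltW.
have mp01 : measurable ([set 0] `|` [set 1] : set (measurableTypeR R)) by exact: measurableU.
rewrite lower_integral_setU//; last first.
  by apply/disj_setPS => x [/=]; rewrite in_itv/= => /andP[x0 x1] [] xE;
    move: x0 x1; rewrite xE ltxx.
rewrite [X in (_ + X)%E]lower_integral_null ?adde0//; last first.
  by move=> x _; rewrite lee_fin.
apply/eqP; rewrite eq_le measure_ge0 andbT.
apply: le_trans (measureU2 _ _ _) _ => //.
by rewrite [X in (X + _)%E]lebesgue_measure_set1 [X in (_ + X)%E]lebesgue_measure_set1 adde0.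
Qed.

Lemma lower_integral_halves (F : R -> R) : (forall y, 0 <= F y) ->
  (\int[mu]_(t in `]0%R, 1%R[) (F t)%:E =
   \int[mu]_(t in `]0%R, (1 / 2)%R[) (F t)%:E + \int[mu]_(t in `](1 / 2)%R, 1%R[) (F t)%:E)%E.
Proof.
move=> F0.
have mp (x : R) : measurable ([set x] : set (measurableTypeR R)) by [].
have -> : `]0, 1[%classic = (`]0, 1 / 2[ `|` `]1 / 2, 1[) `|` [set 1 / 2] :> set R.
  apply/seteqP; split=> x /=; rewrite !in_itv/=.
    move=> /andP[x0 x1]; have [x2|x2|->] := ltgtP x (1 / 2); last by right.
      by left; left; rewrite x0.
    by left; right; rewrite x1.
  by move=> [[]|->] *; lra.
rewrite lower_integral_setU//; last 2 first.
- exact: measurableU.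
- by apply/disj_setPS => x [/=] []; rewrite in_itv/= => /andP[x0 x1] xE;
    move: x0 x1; rewrite xE ltxx.
rewrite [X in (_ + X)%E]lower_integral_null ?adde0//; last 2 first.
- exact: lebesgue_measure_set1.
- by move=> x _; rewrite lee_fin.
rewrite lower_integral_setU//.
by apply/disj_setPS => x [/=]; rewrite !in_itv/= => /andP[_ x1] /andP[x2 _]; lra.
Qed.

End Reparametrisation.

Section NormScaling.
Context {R : realType} {M : closedManifold R}.

(** The supremum of a set that is empty or unbounded is 0, which is consistent
    with scaling. *)
Lemma sup_scale (a : R) (S : set R) : 0 < a -> sup [set a * x | x in S] = a * sup S.
Proof.
have le (b : R) (T : set R) : 0 < b -> has_sup T -> sup [set b * x | x in T] <= b * sup T.
  move=> b0 [[x Tx] [y ubT]]; apply: ge_sup; first by exists (b * x); exists x.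
  move=> _ [z Tz <-]; rewrite ler_pM2l//; apply: ub_le_sup => //.
  by exists y.
have hs (b : R) (T : set R) : 0 < b -> has_sup T -> has_sup [set b * x | x in T].
  move=> b0 [[x Tx] [y ubT]]; split; first by exists (b * x); exists x.
  by exists (b * y) => _ [z Tz <-]; rewrite ler_pM2l//; exact: ubT.
move=> a0; have ai0 : 0 < a^-1 by rewrite invr_gt0.
have aK : [set a^-1 * y | y in [set a * x | x in S]] = S.
  apply/seteqP; split=> [_ [_ [x Sx <-] <-]|x Sx]; first by rewrite mulKf// gt_eqF.
  by exists (a * x); [exists x|rewrite mulKf// gt_eqF].
have [hS|nS] := pselect (has_sup S); last first.
  rewrite !sup_out ?mulr0// => hS; apply: nS; rewrite -aK; exact: hs.
apply/eqP; rewrite eq_le le//= -ler_pdivlMl//.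
by rewrite -{1}aK le//; exact: hs.
Qed.

Variables (g : VF M -> VF M -> Cinf M)
  (vol : {measure set (g_sigma_algebraType (@open M)) -> \bar R})
  (nB : B1 M -> R) (mu : {linear Z1 M -> B1 M}) (c : R).
Hypotheses (nB_norm : is_norm nB) (c_ge0 : 0 <= c).

Lemma fineZ (k : R) (x : \bar R) : 0 < k -> fine (k%:E * x)%E = k * fine x.
Proof.
by move=> k0; case: x => [r| |] //=; rewrite ?gt0_muley ?gt0_muleNy ?lte_fin//= mulr0.
Qed.

Lemma covector_norm_scale (a : R) (alpha : VF M -> Cinf M) x : 0 < a ->
  covector_norm g (a *: alpha) x = a * covector_norm g alpha x.
Proof.
move=> a0; rewrite /covector_norm -sup_scale//; congr sup.
apply/seteqP; split=> [_ [X gX <-]|_ [_ [X gX <-] <-]]; last by exists X.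
by exists (alpha X x) => //; exists X.
Qed.

Lemma L2norm_scale (a : R) (alpha : VF M -> Cinf M) : 0 < a ->
  L2norm g vol (a *: alpha) = a * L2norm g vol alpha.
Proof.
move=> a0; rewrite /L2norm /Rintegral.
under eq_integral do rewrite covector_norm_scale// exprMn EFinM.
rewrite lower_integralZl//; last 2 first.
- by rewrite exprn_gt0.
- by move=> x _; rewrite lee_fin sqr_ge0.
rewrite fineZ ?exprn_gt0// sqrtrM ?sqr_ge0// sqrtr_sqr gtr0_norm//.
Qed.

Lemma is_norm_ge0 (V : lmodType R) (N : V -> R) v : is_norm N -> 0 <= N v.
Proof.
move=> [_ NZ ND]; have N0 : N 0 = 0 by rewrite -(scale0r (0 : V)) NZ normr0 mul0r.
have := ND v (-1 *: v); rewrite NZ normrN1 mul1r scaleN1r subrr N0.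
by rewrite -mulr2n pmulrn_lge0.
Qed.

Lemma L2norm_ge0 (alpha : VF M -> Cinf M) : 0 <= L2norm g vol alpha.
Proof. exact: sqrtr_ge0. Qed.

Lemma n_mu_ge0 (alpha : Z1 M) : 0 <= n_mu g vol nB mu c alpha.
Proof. by rewrite addr_ge0 ?mulr_ge0 ?L2norm_ge0//; exact: is_norm_ge0. Qed.

Lemma n_mu_scale (a : R) (alpha : Z1 M) : 0 < a ->
  n_mu g vol nB mu c (a *: alpha) = a * n_mu g vol nB mu c alpha.
Proof.
move=> a0; have [_ NZ _] := nB_norm.
rewrite /n_mu linearZ NZ gtr0_norm// mulrDr; congr (_ + _).
have -> : Z1_val (a *: alpha) - B1_val (a *: mu alpha) =
    a *: (Z1_val alpha - B1_val (mu alpha)) :> (VF M -> Cinf M) by rewrite scalerBr.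
by rewrite L2norm_scale// mulrCA.
Qed.

(** A form is closed together with its nonzero multiples; for a form that is not
    closed both sides are 0. *)
Lemma insubd_scale (a : R) (alpha : VF M -> Cinf M) : a != 0 ->
  (insubd 0 (a *: alpha) : Z1 M) = a *: insubd 0 alpha.
Proof.
move=> a0; have [ca|nca] := boolP (alpha \in closed_form).
  apply: val_inj; rewrite insubdK ?rpredZ//.
  rewrite -[RHS]/(a *: val (insubd (0 : Z1 M) alpha)) insubdK//.
have nca' : a *: alpha \notin closed_form.
  apply: contra nca => H; rewrite -[alpha](scalerK a0); exact: rpredZ.
by rewrite /insubd !insubN//= scaler0.
Qed.

End NormScaling.

(** * Subadditivity *)

Section Infima.
Context {R : realType}.
Implicit Types A B C : set R.

Lemma inf_ge0 A : (forall x, A x -> 0 <= x) -> 0 <= inf A.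
Proof.
move=> A0; have [[x Ax]|nA] := pselect (A !=set0).
  by apply: lb_le_inf; [exists x|exact: A0].
by rewrite inf_out// => -[].
Qed.

Lemma inf_le_add A B C : (forall x, A x -> 0 <= x) -> B !=set0 -> C !=set0 ->
  (forall x y, B x -> C y -> exists2 z, A z & z <= x + y) ->
  inf A <= inf B + inf C.
Proof.
move=> A0 B0 C0 H; rewrite -lerBlDr; apply: lb_le_inf => // x Bx.
rewrite lerBlDr addrC -lerBlDr; apply: lb_le_inf => // y Cy.
rewrite lerBlDr addrC; have [z Az] := H x y Bx Cy; apply: le_trans.
by apply: ge_inf => //; exists 0 => ?; exact: A0.
Qed.

(** An infinite summand makes the sum infinite, and fine sends it to 0. *)
Lemma fine_add_le (x y : \bar R) : (0 <= x)%E -> (0 <= y)%E ->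
  fine (x + y)%E <= fine x + fine y.
Proof.
by case: x => [x| |]//; case: y => [y| |]//= x0 y0; rewrite ?addr0 ?add0r.
Qed.

End Infima.

Section Subadditivity.
Context {R : realType} {M : closedManifold R}.
Variables (omega : VF M -> VF M -> Cinf M) (omega_symp : symplectic_form omega).
Variables (g : VF M -> VF M -> Cinf M)
  (vol : {measure set (g_sigma_algebraType (@open M)) -> \bar R})
  (nB : B1 M -> R) (mu : {linear Z1 M -> B1 M}) (c : R).
Hypotheses (nB_norm : is_norm nB) (c_ge0 : 0 <= c).

Let length := length omega g vol nB mu c.
Let dist_id := dist_id omega g vol nB mu c.
Let Delta := Delta omega g vol nB mu c.

Let speed Psi t : R := n_mu g vol nB mu c (insubd 0 (alpha_path omega Psi t)).

Let speed_ge0 Psi t : 0 <= speed Psi t.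
Proof. exact: n_mu_ge0. Qed.

Let speed_scale Psi Phi s t a : 0 < a ->
  velocity Psi s = cst_fun a *: velocity Phi t -> speed Psi s = a * speed Phi t.
Proof.
move=> a0 v; rewrite /speed /alpha_path v omega_cst_scale//.
by rewrite insubd_scale ?gt_eqF// n_mu_scale.
Qed.

Lemma length_ge0 Psi : 0 <= length Psi.
Proof.
by apply: fine_ge0; apply: integral_ge0 => t _; rewrite lee_fin; exact: speed_ge0.
Qed.

Let lengthE Psi : length Psi =
  fine (\int[lebesgue_measure]_(t in `]0%R, 1%R[) (speed Psi t)%:E)%E.
Proof. by rewrite -lower_integral_open//; exact: speed_ge0. Qed.

(** The integrals of the speeds add up exactly; what turns the equality into an
    inequality is that an integral with value +oo gives length 0. *)
Lemma length_concat Psi Phi : symp_path omega Psi -> symp_path omega Phi ->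
  length (concat Psi Phi) <= length Psi + length Phi.
Proof.
move=> sPsi sPhi; have [ssPsi _ Psi0] := sPsi; have [ssPhi _ Phi0] := sPhi.
have jPsi := symp_path_surj sPsi; have jPhi := symp_path_surj sPhi.
have E1 : (\int[lebesgue_measure]_(t in `]0%R, (1 / 2)%R[) (speed (concat Psi Phi) t)%:E =
    \int[lebesgue_measure]_(t in `]0%R, 1%R[) (speed Phi t)%:E)%E.
  apply: etrans (lower_integral_time1 (speed_ge0 Phi)).
  apply: eq_integral => t /set_mem; rewrite /= in_itv/= => /andP[t0 t2].
  congr EFin; apply: speed_scale; first exact: time1'_gt0.
  exact: (concat_velocity_left ssPsi ssPhi Psi0 jPsi jPhi (ltW t0) t2).
have E2 : (\int[lebesgue_measure]_(t in `](1 / 2)%R, 1%R[) (speed (concat Psi Phi) t)%:E =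
    \int[lebesgue_measure]_(t in `]0%R, 1%R[) (speed Psi t)%:E)%E.
  apply: etrans (lower_integral_time2 (speed_ge0 Psi)).
  apply: eq_integral => t /set_mem; rewrite /= in_itv/= => /andP[t2 t1].
  congr EFin; apply: speed_scale; first exact: time2'_gt0.
  exact: (concat_velocity_right ssPsi ssPhi Psi0 jPsi jPhi t2 (ltW t1)).
have E := lower_integral_halves (speed_ge0 (concat Psi Phi)).
rewrite E1 E2 in E; rewrite (addrC (length Psi) (length Phi)).
rewrite (lengthE (concat Psi Phi)) E (lengthE Psi) (lengthE Phi).
have i0 Xi : (0 <= \int[lebesgue_measure]_(t in `]0%R, 1%R[) (speed Xi t)%:E)%E.
  by apply: integral_ge0 => t _; rewrite lee_fin.
exact: fine_add_le (i0 Phi) (i0 Psi).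
Qed.

Lemma dist_id_ge0 h : 0 <= dist_id h.
Proof. by apply: inf_ge0 => _ [Psi _ <-]; exact: length_ge0. Qed.

Lemma dist_id_comp h k : Symp0 omega h -> Symp0 omega k ->
  dist_id (h \o k) <= dist_id h + dist_id k.
Proof.
move=> [Psi sPsi PsiE] [Phi sPhi PhiE]; apply: inf_le_add.
- by move=> _ [Xi _ <-]; exact: length_ge0.
- by exists (length Psi), Psi.
- by exists (length Phi), Phi.
- move=> _ _ [Psi' [sPsi' PsiE'] <-] [Phi' [sPhi' PhiE'] <-].
  exists (length (concat Psi' Phi')); last exact: length_concat.
  exists (concat Psi' Phi') => //; split; first exact: symp_path_concat.
  by rewrite concat1 PsiE' PhiE'.
Qed.

(** (p^-1 h) (q^-1 k) = r^-1 (h k) with r = (h q h^-1) p in Ham. *)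
Lemma Delta_comp h k : Symp0 omega h -> Symp0 omega k ->
  Delta (h \o k) <= Delta h + Delta k.
Proof.
move=> Sh Sk; apply: inf_le_add.
- by move=> _ [p _ <-]; exact: dist_id_ge0.
- by exists (dist omega g vol nB mu c id h), id => //; exact: Ham_id.
- by exists (dist omega g vol nB mu c id k), id => //; exact: Ham_id.
move=> _ _ [p Hp <-] [q Hq <-].
have Sp := Ham_Symp0 Hp; have Sq := Ham_Symp0 Hq.
pose r := (h \o q \o inv_map h) \o p.
have Hr : Ham omega r by apply: Ham_comp => //; exact: Ham_conj.
exists (dist omega g vol nB mu c r (h \o k)); first by exists r.
have [rK Kr] := Symp0_inv_mapK (Ham_Symp0 Hr).
have [pK Kp] := Symp0_inv_mapK Sp; have [qK Kq] := Symp0_inv_mapK Sq.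
have [hK Kh] := Symp0_inv_mapK Sh.
have E : inv_map r \o (h \o k) = (inv_map p \o h) \o (inv_map q \o k).
  apply/funext => x; apply: (can_inj rK); rewrite /= Kr.
  by rewrite /r /= Kp hK Kq.
rewrite /dist E; apply: dist_id_comp; apply: Symp0_comp => //; exact: Symp0_inv.
Qed.

End Subadditivity.

Theorem proposition3p3 (R : realType) (M : closedManifold R)
    (omega : VF M -> VF M -> Cinf M) (omega_symp : symplectic_form omega)
    (g : VF M -> VF M -> Cinf M) (g_riem : riemannian_metric g)
    (vol : {measure set (g_sigma_algebraType (@open M)) -> \bar R})
    (vol_g : riemannian_volume g vol)
    (nB : B1 M -> R) (nB_norm : is_norm nB)
    (mu : {linear Z1 M -> B1 M}) (c : R) (c_ge0 : 0 <= c) (c_neq0 : c != 0)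
    (psi : M -> M) (psi_symp : Symp0 omega psi) :
  let Delta := Delta omega g vol nB mu c in
  let Rpsi := Num.max (Delta psi) (Delta (inv_map psi)) in
  forall phi : M -> M, Symp0 omega phi ->
    `|Delta (psi \o phi) - Delta phi| <= Rpsi.
Proof.
move=> Delta Rpsi phi phi_symp.
have [psiK _] := Symp0_inv_mapK psi_symp.
rewrite ler_norml; apply/andP; split.
  have D := Delta_comp omega_symp g vol mu nB_norm c_ge0 (Symp0_inv psi_symp)
    (Symp0_comp psi_symp phi_symp).
  rewrite (_ : inv_map psi \o (psi \o phi) = phi) in D; last first.
    by apply/funext => x /=; rewrite psiK.
  rewrite lerNl opprB lerBlDr; apply: le_trans D _; rewrite lerD2r.
  by rewrite le_max lexx orbT.
rewrite lerBlDr.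
apply: le_trans (Delta_comp omega_symp g vol mu nB_norm c_ge0 psi_symp phi_symp) _.
by rewrite lerD2r le_max lexx.
Qed.
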